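(* Let $\Gamma$ be a finite simplicial complex and fix an orientation $\mathcal O$. For $0\le k\le\dim\Gamma$ let $W_k$ be the diagonal matrix indexed by $\underline X_k$ with entries $H(\underline\sigma)=\mathrm{LP}(\underline\sigma)/(k+1)!$. Then: (i) $\delta_k=W_{k+1}^{1/2}\partial_k^*W_k^{-1/2}$ equals the matrix $\delta_k^{\mathcal O}$ with $(\delta_k^{\mathcal O})_{\tau\sigma}=[\tau:\sigma]H(\underline\tau)^{1/2}H(\underline\sigma)^{-1/2}$ if $\underline\sigma\subset\underline\tau$ and $0$ otherwise; (ii) $\Delta_k^{\mathrm{up}}=-A_k^{\mathcal O,\mathrm{up}}$ and $\Delta_k^{\mathrm{down}}=-A_k^{\mathcal O,\mathrm{down}}$; (iii) the spectra of $\Delta_k^{\mathrm{up}}$ and $\Delta_k^{\mathrm{down}}$ are bounded above by $1$; (iv) for $1\le k\le\dim\Gamma$, the spectral gaps $1-\lambda_{\max}(\Delta_{k-1}^{\mathrm{up}})$ and $1-\lambda_{\max}(\Delta_k^{\mathrm{down}})$ coincide, and they equal $0$ if and only if $\Gamma$ admits a coherent-up-component in dimension $k-1$, equivalently a coherent-down-component in dimension $k$; moreover the multiplicities of $1$ as an eigenvalue of $\Delta_{k-1}^{\mathrm{up}}$ and of $\Delta_k^{\mathrm{down}}$ coincide and equal the number of such components.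
   Context: Let $V$ be a finite set. A simplicial complex is a set $\underline X$ of nonempty subsets of $V$ (faces) containing all singletons and closed under nonempty subsets; a $k$-face has $k+1$ elements; $\underline X_k$ is the set of $k$-faces. For $k\ge1$ an oriented $k$-face is an ordering of a $k$-face up to even permutations, $-\sigma$ the opposite orientation; a vertex $x$ has the two oriented $0$-faces $[x],-[x]$. An orientation $\mathcal O$ chooses an oriented face $\sigma=\mathcal O(\underline\sigma)$ over each face. Write $\underline\sigma\subset\underline\tau$ if the $k$-face $\underline\sigma$ lies in the $(k+1)$-face $\underline\tau$. For $\tau=[x_0,\dots,x_{k+1}]$ and $\sigma$ with support $\underline\tau\setminus\{x_i\}$, $[\tau:\sigma]=+1$ iff $\sigma$ equals $[x_0,\dots,\widehat{x_i},\dots,x_{k+1}]$ for $i$ even, resp. its opposite for $i$ odd, else $-1$. A leaf is a face contained in no larger face. $\mathrm{LP}(\underline\sigma)=1$ for leaves, $\mathrm{LP}(\underline\sigma)=\sum_{\underline\tau\supset\underline\sigma}\mathrm{LP}(\underline\tau)$ otherwise. $\partial_k^*$ is the matrix (rows $\underline X_{k+1}$, columns $\underline X_k$) with entries $[\tau:\sigma]$ if $\underline\sigma\subset\underline\tau$, else $0$; $\delta_k=W_{k+1}^{1/2}\partial_k^*W_k^{-1/2}$, $\Delta_k^{\mathrm{up}}=\delta_k^T\delta_k$, $\Delta_k^{\mathrm{down}}=\delta_{k-1}\delta_{k-1}^T$ ($\Delta_0^{\mathrm{down}}=0$). Write $\underline\sigma\sim^{\mathrm{up}}_=\underline\sigma'$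 if $\underline\sigma,\underline\sigma'$ are distinct $k$-faces contained in a common $(k+1)$-face, or $\underline\sigma=\underline\sigma'$ is not a leaf; $\underline\sigma\sim^{\mathrm{down}}_=\underline\sigma'$ ($k\ge1$) if they are distinct $k$-faces sharing a $(k-1)$-face, or equal. Define $(A_k^{\mathcal O,\mathrm{up}})_{\sigma\sigma'}=-H(\underline\sigma)^{-1/2}H(\underline\sigma')^{-1/2}\sum_{\underline\tau\supset\underline\sigma,\underline\sigma'}[\tau:\sigma][\tau:\sigma']H(\underline\tau)$ if $\underline\sigma\sim^{\mathrm{up}}_=\underline\sigma'$ and $0$ otherwise, and $(A_k^{\mathcal O,\mathrm{down}})_{\sigma\sigma'}=-H(\underline\sigma)^{1/2}H(\underline\sigma')^{1/2}\sum_{\underline\rho\subset\underline\sigma,\underline\sigma'}[\sigma:\rho][\sigma':\rho]H(\underline\rho)^{-1}$ if $\underline\sigma\sim^{\mathrm{down}}_=\underline\sigma'$ and $0$ otherwise (with $\tau=\mathcal O(\underline\tau)$, $\rho=\mathcal O(\underline\rho)$). Components: distinct $k$-faces are up-adjacent if their union is a $(k+1)$-face, down-adjacent if their intersection is a $(k-1)$-face. A quotient-up-(resp. down-)component in dimension $k$ is a maximal set of $k$-faces connected under up-(resp. down-)adjacency. A coherent-up-component in dimension $k$ is a quotient-up-component $\underline C$ that is not a single leaf and for which there is an orientation $\mathcal O$ with $[\tau:\mathcal O(\underline\sigma)]=[\tau:\mathcal O(\underline\sigma')]$ for all $\underline\sigma,\underline\sigma'\in\underline C$ and every oriented $(k+1)$-face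 $\tau$ with $\underline\sigma,\underline\sigma'\subset\underline\tau$. A coherent-down-component in dimension $k$ is a quotient-down-component $\underline C$ that is not a single vertex (root) for which there is an orientation with $[\mathcal O(\underline\sigma):\rho]=[\mathcal O(\underline\sigma'):\rho]$ for all $\underline\sigma,\underline\sigma'\in\underline C$ and every oriented $(k-1)$-face $\rho$ with $\underline\rho\subset\underline\sigma,\underline\sigma'$. *)

(* Defs.v *)
From mathcomp Require Import all_boot all_order all_fingroup all_algebra.
From mathcomp Require Import boolp reals.

Set Implicit Arguments.
Unset Strict Implicit.
Unset Printing Implicit Defensive.

Import Order.TTheory GRing.Theory Num.Theory.

Local Open Scope ring_scope.

Record scomplex (V : finType) := SComplex {
  faces :> {set {set V}};
  _ : set0 \notin faces;
  _ : forall x : V, [set x] \in faces;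
  _ : forall s t : {set V}, t \in faces -> s \subset t -> s != set0 -> s \in faces
}.

Definition kfaces (V : finType) (X : scomplex V) (k : nat) : {set {set V}} :=
  [set s in X | #|s| == k.+1].

Definition kface (V : finType) (X : scomplex V) (k : nat)
    (i : 'I_#|kfaces X k|) : {set V} :=
  enum_val i.

(* Integer-valued, so that the empty complex has dimension -1. *)
Definition sdim (V : finType) (X : scomplex V) : int :=
  (\max_(s in X) #|s|)%N%:Z - 1.

Definition leaf (V : finType) (X : scomplex V) (s : {set V}) : bool :=
  (s \in X) && ~~ [exists t in X, s \proper t].

(* The fuel n bounds the number of faces in a chain starting at s; the value
   at n = 0 is never reached from LP, see LP_leaf and LP_nonleaf. *)
Fixpoint LP_rec (V : finType) (X : scomplex V) (n : nat) (s : {set V}) : nat :=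
  if n is m.+1 then
    if leaf X s then 1%N
    else (\sum_(t in X | (s \subset t) && (#|t| == #|s|.+1)) LP_rec X m t)%N
  else 0%N.

Definition LP (V : finType) (X : scomplex V) (s : {set V}) : nat :=
  LP_rec X (#|V|.+1 - #|s|) s.

Lemma LP_leaf (V : finType) (X : scomplex V) (s : {set V}) :
  leaf X s -> LP X s = 1%N.
Proof.
by move=> ls; rewrite /LP subSn ?max_card //= ls.
Qed.

Lemma LP_nonleaf (V : finType) (X : scomplex V) (s : {set V}) :
  ~~ leaf X s ->
  LP X s = (\sum_(t in X | (s \subset t) && (#|t| == #|s|.+1)) LP X t)%N.
Proof.
move=> ls; rewrite {1}/LP subSn ?max_card //= (negPf ls).
by apply: eq_bigr => t /and3P[_ _ /eqP ct]; rewrite /LP ct subSS.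
Qed.

(* A k-face has k.+1 = #|s| elements. *)
Definition wt (R : realType) (V : finType) (X : scomplex V) (s : {set V}) : R :=
  (LP X s)%:R / (#|s|`!)%:R.

(* For k >= 1 an oriented k-face is a class of orderings modulo even
   permutations; an oriented 0-face is a vertex with a sign, (x, true) being
   [x] and (x, false) being -[x]. Not every inhabitant of oface V k is an
   oriented face: see oriented_over. *)
Definition oface (V : finType) (k : nat) : finType :=
  if k is m.+1 then {set m.+2.-tuple V} : finType else (V * bool)%type : finType.

Definition permute (V : finType) (n : nat) (t : n.-tuple V) (p : 'S_n) :
    n.-tuple V :=
  [tuple tnth t (p i) | i < n].

(* [x_0, ..., x_k] *)
Definition oclass (V : finType) (k : nat) : k.+1.-tuple V -> oface V k :=
  match k with
  | 0 => fun t => (thead t, true)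
  | m.+1 => fun t =>
      [set permute t p | p in [set p : 'S_m.+2 | ~~ odd_perm p]]
  end.

Definition oopp (V : finType) (k : nat) : oface V k -> oface V k :=
  match k with
  | 0 => fun o => (o.1, ~~ o.2)
  | m.+1 => fun o =>
      [set permute t p | t in o, p in [set p : 'S_m.+2 | odd_perm p]]
  end.

Definition oriented_over (V : finType) (k : nat) (o : oface V k)
    (s : {set V}) : bool :=
  [exists t : k.+1.-tuple V,
     [&& uniq t, [set x in t] == s & (o == oclass t) || (o == oopp (oclass t))]].

(* Only the values at k-faces s are meaningful. *)
Record orientation (V : finType) (X : scomplex V) := Orientation {
  orient :> forall k : nat, {set V} -> oface V k;
  _ : forall (k : nat) (s : {set V}),
        s \in kfaces X k -> oriented_over (orient k s) s
}.

Definition del (V : finType) (k : nat) (t : k.+2.-tuple V) (i : 'I_k.+2) :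
    k.+1.-tuple V :=
  [tuple tnth t (lift i j) | j < k.+1].

(* Meaningful only when the support of o is a facet of the support of q. *)
Definition inc (V : finType) (k : nat) (q : oface V k.+1) (o : oface V k) : int :=
  if [exists t : k.+2.-tuple V, exists i : 'I_k.+2,
        (q == oclass t) &&
        (o == (if odd i then oopp (oclass (del t i)) else oclass (del t i)))]
  then 1 else -1.

Section Matrices.
Variables (R : realType) (V : finType) (X : scomplex V) (O : orientation X).

Definition W (k : nat) : 'M[R]_#|kfaces X k| :=
  diag_mx (\row_i wt R X (kface i)).

(* W k is diagonal with nonnegative entries, so its nonnegative square root is
   taken entrywise. *)
Definition W_half (k : nat) : 'M[R]_#|kfaces X k| := map_mx Num.sqrt (W k).

Definition W_neghalf (k : nat) : 'M[R]_#|kfaces X k| := invmx (W_half k).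

Definition dstar (k : nat) : 'M[R]_(#|kfaces X k.+1|, #|kfaces X k|) :=
  \matrix_(i, j)
    let t := kface i in let s := kface j in
    if s \subset t then (inc (O k.+1 t) (O k s))%:~R else 0.

Definition delta (k : nat) : 'M[R]_(#|kfaces X k.+1|, #|kfaces X k|) :=
  W_half k.+1 *m dstar k *m W_neghalf k.

Definition deltaO (k : nat) : 'M[R]_(#|kfaces X k.+1|, #|kfaces X k|) :=
  \matrix_(i, j)
    let t := kface i in let s := kface j in
    if s \subset t then
      (inc (O k.+1 t) (O k s))%:~R * Num.sqrt (wt R X t) * (Num.sqrt (wt R X s))^-1
    else 0.

Definition Lap_up (k : nat) : 'M[R]_#|kfaces X k| := (delta k)^T *m delta k.

Definition Lap_down (k : nat) : 'M[R]_#|kfaces X k| :=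
  if k is m.+1 then delta m *m (delta m)^T else 0.

Definition sim_up (k : nat) (s s' : {set V}) : bool :=
  ((s != s') && [exists t in kfaces X k.+1, (s \subset t) && (s' \subset t)])
  || ((s == s') && ~~ leaf X s).

(* Relates k.+1-faces. *)
Definition sim_down (k : nat) (s s' : {set V}) : bool :=
  ((s != s') && [exists r in kfaces X k, (r \subset s) && (r \subset s')])
  || (s == s').

Definition A_up (k : nat) : 'M[R]_#|kfaces X k| :=
  \matrix_(i, j)
    let s := kface i in let s' := kface j in
    if sim_up k s s' then
      - ((Num.sqrt (wt R X s))^-1 * (Num.sqrt (wt R X s'))^-1 *
         \sum_(t in kfaces X k.+1 | (s \subset t) && (s' \subset t))
           (inc (O k.+1 t) (O k s))%:~R * (inc (O k.+1 t) (O k s'))%:~R * wt R X t)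
    else 0.

(* There are no (-1)-faces, so A_down 0 is the zero matrix. *)
Definition A_down (k : nat) : 'M[R]_#|kfaces X k| :=
  match k with
  | 0 => 0
  | m.+1 => \matrix_(i, j)
    let s := kface i in let s' := kface j in
    if sim_down m s s' then
      - (Num.sqrt (wt R X s) * Num.sqrt (wt R X s') *
         \sum_(r in kfaces X m | (r \subset s) && (r \subset s'))
           (inc (O m.+1 s) (O m r))%:~R * (inc (O m.+1 s') (O m r))%:~R
           * (wt R X r)^-1)
    else 0
  end.

End Matrices.

Definition is_lambda_max (R : realType) (n : nat) (A : 'M[R]_n) (l : R) : Prop :=
  eigenvalue A l /\ forall a : R, eigenvalue A a -> a <= l.

Definition eig_mult (R : realType) (n : nat) (A : 'M[R]_n) (a : R) : nat :=
  mup a (char_poly A).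

Section Components.
Variables (V : finType) (X : scomplex V).

Definition up_adj (k : nat) : rel {set V} := fun s s' =>
  [&& s \in kfaces X k, s' \in kfaces X k, s != s' & s :|: s' \in kfaces X k.+1].

(* At k = 0 the relation is empty, since set0 is not a face. *)
Definition down_adj (k : nat) : rel {set V} := fun s s' =>
  [&& s \in kfaces X k, s' \in kfaces X k, s != s',
      s :&: s' \in X & #|s :&: s'| == k].

Definition connected_set (e : rel {set V}) (C : {set {set V}}) : bool :=
  [forall s in C, forall s' in C,
     connect [rel u v | [&& u \in C, v \in C & e u v]] s s'].

Definition component (e : rel {set V}) (D C : {set {set V}}) : bool :=
  maxset (fun B => [&& B != set0, B \subset D & connected_set e B]) C.

Definition quotient_up_component (k : nat) (C : {set {set V}}) : bool :=
  component (up_adj k) (kfaces X k) C.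

Definition quotient_down_component (k : nat) (C : {set {set V}}) : bool :=
  component (down_adj k) (kfaces X k) C.

Definition coherent_up_component (k : nat) (C : {set {set V}}) : Prop :=
  [/\ quotient_up_component k C,
      ~ (exists2 s, leaf X s & C = [set s])
    & exists O : orientation X,
      forall s s' : {set V}, s \in C -> s' \in C ->
      forall (t : {set V}) (q : oface V k.+1),
        t \in kfaces X k.+1 -> oriented_over q t ->
        s \subset t -> s' \subset t ->
        inc q (O k s) = inc q (O k s')].

(* The orientation condition is empty at k = 0, where every
   quotient-down-component is a single vertex. *)
Definition coherent_down_component (k : nat) (C : {set {set V}}) : Prop :=
  [/\ quotient_down_component k C,
      ~ (exists x : V, C = [set [set x]])
    & match k with
      | 0 => True
      | m.+1 => exists O : orientation X,
        forall s s' : {set V}, s \in C -> s' \in C ->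
        forall (r : {set V}) (o : oface V m),
          r \in kfaces X m -> oriented_over o r ->
          r \subset s -> r \subset s' ->
          inc (O m.+1 s) o = inc (O m.+1 s') o
      end].

Definition num_coherent_up (k : nat) : nat :=
  #|[set C : {set {set V}} | `[< coherent_up_component k C >]]|.

Definition num_coherent_down (k : nat) : nat :=
  #|[set C : {set {set V}} | `[< coherent_down_component k C >]]|.

End Components.

(* Main.v *)
Require Import Defs.
From mathcomp Require Import all_boot all_order all_fingroup all_algebra.
From mathcomp Require Import boolp reals complex spectral sesquilinear ring.

(* Write p(s) = H(s)^(1/2) on k-faces and q(t) = (k+2) H(t)^(1/2) on
   (k+1)-faces. Since a (k+1)-face has k+2 facets and the H(t) of the cofacets
   of a non-leaf s add up to H(s)/(k+2), the matrix |delta_k| maps p to q and its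
   transpose maps q back to p (away from leaves). This is the setting of the
   Schur test: |v|^2 - |delta_k v|^2 is a sum of squares, so the spectra are
   bounded by 1, and v is a 1-eigenvector iff v vanishes on leaves and
   [t:s] v(s)/p(s) does not depend on the facet s of t. Then |v|/p is constant on
   components, and the signs of v reorient a component coherently wherever v is
   nonzero; hence the 1-eigenspace has a basis indexed by the coherent
   components. The hypotheses are symmetric under transposition, so the same
   argument applies to the down-Laplacian. *)

Set Implicit Arguments.
Unset Strict Implicit.
Unset Printing Implicit Defensive.

Import Order.TTheory GRing.Theory Num.Theory.
Local Open Scope ring_scope.

(** * Symmetric and Gram matrices *)

(** Nonzero rows with pairwise disjoint supports are linearly independent, so the rows [b c] with
    [c] in [P] form a basis of the row space of [K]. This serves both the eigenspaces of a diagonal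
    matrix and the eigenvectors carried by components. *)
Lemma rank_disjoint_rows (F : fieldType) (m n : nat) (K : 'M[F]_(m, n))
    (S : finType) (P : {set S}) (b : S -> 'I_n -> F) :
  (forall c, c \in P -> exists i, b c i != 0) ->
  (forall c c' i, c \in P -> c' \in P -> b c i != 0 -> b c' i != 0 -> c = c') ->
  (forall c, c \in P -> (\row_i b c i <= K)%MS) ->
  (forall v : 'rV_n, (v <= K)%MS ->
     exists a : S -> F, forall i, v 0 i = \sum_(c in P) a c * b c i) ->
  \rank K = #|P|.
Proof.
move=> b0 bdisj bK Kb.
pose B := \matrix_(c < #|P|, i < n) b (enum_val c) i.
have Bfree : row_free B.
  apply: inj_row_free => v vB0; apply/rowP => c; rewrite mxE.
  (* At a column [x] in the support of row [c] all other rows vanish, which isolates the coefficient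
     of [c]. *)
  have [x bx0] := b0 _ (enum_valP c).
  have /rowP/(_ x) := vB0; rewrite !mxE (bigD1 c) //= big1 => [|c' c'c].
    by rewrite addr0 mxE => /eqP; rewrite mulf_eq0 (negPf bx0) orbF => /eqP.
  rewrite mxE; have [->|bc'] := eqVneq (b (enum_val c') x) 0; first by rewrite mulr0.
  have := bdisj _ _ _ (enum_valP _) (enum_valP _) bc' bx0.
  by move/enum_val_inj => c'c0; rewrite c'c0 eqxx in c'c.
rewrite -(eqP Bfree); apply/eqP; rewrite eqn_leq !mxrankS //.
  apply/row_subP => c.
  have -> : row c B = \row_i b (enum_val c) i by apply/rowP => i; rewrite !mxE.
  exact/bK/enum_valP.
apply/row_subP => j; have [a va] := Kb _ (row_sub j K).
apply/submxP; exists (\row_c a (enum_val c)); apply/rowP => i.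
by rewrite va mxE big_enum_val /=; apply: eq_bigr => c _; rewrite !mxE.
Qed.

Lemma mup_prod_XsubC (F : fieldType) (I : finType) (f : I -> F) (a : F) :
  mup a (\prod_i ('X - (f i)%:P)) = #|[set i | f i == a]|.
Proof.
rewrite -sum1dep_card big_mkcond /=.
elim: (index_enum I) => [|i r IHr].
  by rewrite !big_nil; apply/mupNroot; rewrite root1.
rewrite !big_cons mupM ?polyXsubC_eq0 ?IHr //; last first.
  by rewrite prodf_seq_neq0; apply/allP => j _; rewrite polyXsubC_eq0.
by rewrite -['X - _]expr1 mup_XsubCX eq_sym; case: eqP.
Qed.

Lemma char_poly_diag (F : fieldType) n (d : 'rV[F]_n) :
  char_poly (diag_mx d) = \prod_i ('X - (d 0 i)%:P).
Proof.
rewrite char_poly_trig ?diag_mx_is_trig //.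
by apply: eq_bigr => i _; rewrite mxE eqxx.
Qed.

Lemma char_poly_conj (F : fieldType) n (P A : 'M[F]_n) : P \in unitmx ->
  char_poly (invmx P *m A *m P) = char_poly A.
Proof.
(* The conjugation takes place over [{poly F}], where the determinant of [P] is a nonzero constant
   and hence a unit. *)
move=> Pu; have Pu' : map_mx polyC P \in unitmx.
  by rewrite unitmxE det_map_mx poly_unitE size_polyC coefC eqxx /= -unitmxE Pu;
     have := Pu; rewrite unitmxE unitfE => ->.
rewrite /char_poly.
have -> : char_poly_mx (invmx P *m A *m P) =
    invmx (map_mx polyC P) *m char_poly_mx A *m map_mx polyC P.
  rewrite /char_poly_mx mulmxBr mulmxBl !map_mxM /= map_invmx; congr (_ - _).
  by rewrite scalar_mxC -mulmxA mulVmx // mulmx1.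
rewrite !det_mulmx mulrC mulrA -det_mulmx mulmxV // det1 mul1r //.
Qed.

(** The standard basis vectors at the positions where [d] takes the value [a] span the
    eigenspace. *)
Lemma rank_eigenspace_diag (F : fieldType) n (d : 'rV[F]_n) (a : F) :
  \rank (eigenspace (diag_mx d) a) = #|[set i | d 0 i == a]|.
Proof.
apply: (@rank_disjoint_rows _ _ _ _ _ _ (fun c i => (c == i)%:R)).
- by move=> c _; exists c; rewrite eqxx oner_eq0.
- move=> c c' i _ _; case: (eqVneq c i) => [->|]; last by rewrite eqxx.
  by case: (eqVneq c' i) => [->|]; last by rewrite eqxx.
- move=> c; rewrite inE => /eqP dc; apply/eigenspaceP; apply/rowP => i.
  rewrite mul_mx_diag !mxE; by case: eqP => [<-|_]; rewrite ?dc /=; ring.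
- move=> v /eigenspaceP /rowP va; exists (v 0) => i.
  have [di|di] := boolP (d 0 i == a).
    rewrite (bigD1 i) ?inE //= eqxx mulr1 big1 ?addr0 // => j /andP[_ /negPf ->].
    by rewrite mulr0.
  rewrite big1 => [|j]; last first.
    rewrite inE => dj; case: eqP => [ji|]; rewrite ?mulr0 //.
    by rewrite -ji dj in di.
  have := va i; rewrite mul_mx_diag !mxE mulrC => /eqP.
  by rewrite -subr_eq0 -mulrBl mulf_eq0 subr_eq0 (negPf di) => /eqP.
Qed.

Lemma rank_eigenspace_conj (F : fieldType) n (P A : 'M[F]_n) (a : F) :
  P \in unitmx ->
  \rank (eigenspace (invmx P *m A *m P) a) = \rank (eigenspace A a).
Proof.
move=> Pu; rewrite /eigenspace !mxrank_ker; congr (_ - _)%N.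
have -> : invmx P *m A *m P - a%:M = invmx P *m (A - a%:M) *m P.
  rewrite mulmxBr mulmxBl; congr (_ - _).
  by rewrite scalar_mxC -mulmxA mulVmx // mulmx1.
rewrite mxrankMfree ?row_free_unit //.
by rewrite -mxrank_tr trmx_mul mxrankMfree ?mxrank_tr // row_free_unit unitmx_tr unitmx_inv.
Qed.

(** Multiplicity is determined by divisibility by the powers of ['X - a%:P], which a field embedding
    both preserves and reflects. *)
Lemma mup_map_poly (F F' : fieldType) (f : {rmorphism F -> F'}) (p : {poly F}) a :
  p != 0 -> mup (f a) (map_poly f p) = mup a p.
Proof.
move=> p0; have mp0 : map_poly f p != 0 by rewrite map_poly_eq0.
have mE k : (k <= mup (f a) (map_poly f p))%N = (k <= mup a p)%N.
  by rewrite !mup_geq // -(dvdp_map f) rmorphXn /= map_polyXsubC.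
by apply/eqP; rewrite eqn_leq -mE leqnn mE leqnn.
Qed.

(** * Real symmetric matrices, by the spectral theorem over [R[i]] *)

Section Symmetric.
Variables (R : rcfType) (n : nat) (A : 'M[R]_n).
Hypothesis symA : A^T = A.
Let f : {rmorphism R -> R[i]} := real_complex R.
Let AC : 'M[R[i]]_n := map_mx f A.

Let AC_hermitian : AC \is hermsymmx.
Proof.
apply: realsym_hermsym.
  apply/is_hermitianmxP; rewrite expr0 scale1r map_mx_id // /AC.
  by rewrite map_trmx symA.
by apply/mxOverP => i j; rewrite mxE complex_real.
Qed.

Let AC_diag : exists2 P : 'M[R[i]]_n, P \in unitmx &
  AC = invmx P *m diag_mx (spectral_diag AC) *m P.
Proof.
exists (spectralmx AC); first exact: spectral_unit.
exact/orthomx_spectralP/hermitian_normalmx.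
Qed.

(** Algebraic and geometric multiplicity are unchanged by field extension and by conjugation, so it
    is enough to compare them for a diagonal matrix. *)
Lemma mup_char_poly_sym (a : R) : mup a (char_poly A) = \rank (eigenspace A a).
Proof.
rewrite -(mup_map_poly f) ?monic_neq0 ?char_poly_monic //.
rewrite -(mxrank_map f) map_eigenspace map_char_poly -/AC.
have [P Pu ->] := AC_diag.
by rewrite char_poly_conj // rank_eigenspace_conj // char_poly_diag
           mup_prod_XsubC rank_eigenspace_diag.
Qed.

(** The spectral diagonal of a hermitian matrix is real, so the roots of the characteristic
    polynomial descend to [R]. A finite family of eigenvalues is what allows a largest one to be
    chosen. *)
Lemma sym_eigenvalues : exists d : 'I_n -> R,
  forall a, eigenvalue A a <-> exists i, a = d i.
Proof.
have /mxOverP dreal := hermitian_spectral_diag_real AC_hermitian.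
have /choice[d dE] : forall i, exists x, spectral_diag AC 0 i = f x.
  by move=> i; apply/complex_realP/dreal.
exists d => a; rewrite eigenvalue_root_char -(fmorph_root f) map_char_poly -/AC.
have [P Pu ->] := AC_diag; rewrite char_poly_conj // char_poly_diag.
rewrite -(big_map (fun i => spectral_diag AC 0 i) xpredT (fun x => 'X - x%:P)).
rewrite root_prod_XsubC; split=> [/mapP[i _]|[i ->]].
  by rewrite dE => /fmorph_inj ->; exists i.
by rewrite -dE; apply/mapP; exists i; rewrite ?mem_index_enum.
Qed.

End Symmetric.

(** * Gram matrices and the transfer of nonzero eigenvalues to the transpose *)

Section GramMatrix.
Variables (R : realFieldType) (m n : nat) (M : 'M[R]_(m, n)).

Lemma gram_sym : (M^T *m M)^T = M^T *m M.
Proof. by rewrite trmx_mul trmxK. Qed.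

(** Both sides evaluate the quadratic form [v *m (M^T *m M) *m v^T]. *)
Lemma gram_form (v : 'rV[R]_n) a : v *m (M^T *m M) = a *: v ->
  \sum_j (\sum_i M j i * v 0 i) ^+ 2 = a * \sum_i v 0 i ^+ 2.
Proof.
move=> va.
have -> : \sum_j (\sum_i M j i * v 0 i) ^+ 2 = (v *m (M^T *m M) *m v^T) 0 0.
  rewrite mulmxA -[_ *m M *m _]mulmxA -[M *m v^T]trmxK trmx_mul trmxK mxE.
  apply: eq_bigr => j _; rewrite !mxE expr2.
  by congr (_ * _); apply: eq_bigr => i _; rewrite !mxE mulrC.
rewrite va -scalemxAl mxE; congr (_ * _); rewrite mxE.
by apply: eq_bigr => i _; rewrite mxE expr2.
Qed.

Lemma row_sqr_gt0 (v : 'rV[R]_n) : v != 0 -> 0 < \sum_i v 0 i ^+ 2.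
Proof.
move=> v0; rewrite lt0r sumr_ge0 ?andbT => [|i _]; last exact: sqr_ge0.
apply: contra v0 => /eqP s0; apply/eqP/rowP => i; rewrite mxE.
apply/eqP; rewrite -sqrf_eq0; apply/eqP.
by apply: (psumr_eq0P _ s0) => // j _; exact: sqr_ge0.
Qed.

Lemma gram_eigenvalue_ge0 a : eigenvalue (M^T *m M) a -> 0 <= a.
Proof.
move=> /eigenvalueP[v /gram_form va v0].
rewrite -(pmulr_lge0 _ (row_sqr_gt0 v0)) -va; apply: sumr_ge0 => j _; exact: sqr_ge0.
Qed.

Lemma gram_eigenvalue_tr a : a != 0 ->
  eigenvalue (M^T *m M) a -> eigenvalue (M *m M^T) a.
Proof.
move=> a0 /eigenvalueP[v va v0]; apply/eigenvalueP; exists (v *m M^T).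
  by rewrite mulmxA -(mulmxA v) va scalemxAl.
apply: contra v0 => /eqP vM; move: va; rewrite mulmxA vM mul0mx.
by move/esym/eqP; rewrite scaler_eq0 (negPf a0).
Qed.

(** On the eigenspace [M^T *m M] acts as the nonzero scalar [a], so multiplication by [M^T] loses no
    rank there, and its image consists of eigenvectors of [M *m M^T]. *)
Lemma gram_rank_eigenspace_le a : a != 0 ->
  (\rank (eigenspace (M^T *m M) a) <= \rank (eigenspace (M *m M^T) a))%N.
Proof.
move=> a0; set E := eigenspace _ _.
have EE : E *m (M^T *m M) = a *: E by apply/eigenspaceP.
rewrite -(mxrank_scale_nz E a0) -EE mulmxA (leq_trans (mxrankM_maxl _ _)) //.
apply: mxrankS; apply/eigenspaceP.
by rewrite mulmxA -(mulmxA E) EE scalemxAl.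
Qed.

End GramMatrix.

(** * The Schur test with positive weights, and its case of equality *)

Section SchurTest.
Variables (R : realFieldType) (m n : nat) (M : 'M[R]_(m, n)).
Variables (p : 'I_n -> R) (q : 'I_m -> R).
Hypothesis p_gt0 : forall i, 0 < p i.
Hypothesis row_sum : forall j, (exists i, M j i != 0) -> \sum_i `|M j i| * p i = q j.
Hypothesis col_sum : forall i, (exists j, M j i != 0) -> \sum_j `|M j i| * q j = p i.

(* The defect in the Cauchy-Schwarz inequality, by Lagrange's identity. *)
Lemma schur_gap (v : 'rV[R]_n) :
  \sum_i v 0 i ^+ 2 - \sum_j (\sum_i M j i * v 0 i) ^+ 2 =
  \sum_(i | [forall j, M j i == 0]) v 0 i ^+ 2 +
  \sum_j 2^-1 * \sum_i \sum_i' `|M j i| * `|M j i'| * (p i * p i') *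
    (Num.sg (M j i) * (v 0 i / p i) - Num.sg (M j i') * (v 0 i' / p i')) ^+ 2.
Proof.
have p0 i : p i != 0 by rewrite gt_eqF.
rewrite (bigID (fun i => [forall j, M j i == 0])) /= -addrA; congr (_ + _).
(* The column sums distribute each [v 0 i ^+ 2] over the rows, and the row sums then replace [q j].
   Zero rows and zero columns, for which no sum is prescribed, contribute 0. *)
have -> : \sum_(i | ~~ [forall j, M j i == 0]) v 0 i ^+ 2 =
    \sum_j (\sum_i `|M j i| * p i) * (\sum_i `|M j i| * (v 0 i ^+ 2 / p i)).
  rewrite big_mkcond /=.
  transitivity (\sum_i \sum_j `|M j i| * q j * (v 0 i ^+ 2 / p i)).
    apply: eq_bigr => i _; rewrite -mulr_suml; case: ifPn => [|/negbNE/forallP M0].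
      rewrite negb_forall => /existsP ex; rewrite col_sum //; field; exact: p0.
    by rewrite big1 ?mul0r // => j _; rewrite (eqP (M0 j)) normr0 mul0r.
  rewrite exchange_big /=; apply: eq_bigr => j _.
  case: (pselect (exists i, M j i != 0)) => [ex|nex].
    by rewrite row_sum // mulr_sumr; apply: eq_bigr => i _; ring.
  have M0 i : M j i = 0 by apply/eqP/negP => /negP Mi; apply: nex; exists i.
  by rewrite !big1 ?mulr0 // => i _; rewrite M0 normr0 !mul0r.
rewrite -sumrB; apply: eq_bigr => j _.
pose A i i' := `|M j i| * p i * (`|M j i'| * (v 0 i' ^+ 2 / p i')).
pose B i i' := (M j i * v 0 i) * (M j i' * v 0 i').
have -> : (\sum_i `|M j i| * p i) * (\sum_i `|M j i| * (v 0 i ^+ 2 / p i)) =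
  \sum_i \sum_i' A i i' by rewrite big_distrlr.
have -> : (\sum_i M j i * v 0 i) ^+ 2 = \sum_i \sum_i' B i i'.
  by rewrite expr2 big_distrlr.
(* Expanding the square gives [A i i'], [A i' i] and a cross term; exchanging the summations
   identifies the first two totals. *)
suff -> : \sum_i \sum_i' `|M j i| * `|M j i'| * (p i * p i') *
    (Num.sg (M j i) * (v 0 i / p i) - Num.sg (M j i') * (v 0 i' / p i')) ^+ 2 =
    \sum_i \sum_i' A i i' + \sum_i \sum_i' A i i' - 2 * \sum_i \sum_i' B i i'.
  by field.
rewrite [X in _ + X - _]exchange_big /= mulr_sumr -big_split -sumrB /=.
apply: eq_bigr => i _; rewrite mulr_sumr -big_split -sumrB /=; apply: eq_bigr => i' _.
rewrite /A /B.
(* Signs and absolute values become independent variables subject to [sx ^+ 2 * ax = ax], an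
   equation that also holds for a zero entry. *)
have aux x y (ax ay sx sy a b c d : R) : c != 0 -> d != 0 ->
    x = sx * ax -> y = sy * ay -> sx ^+ 2 * ax = ax -> sy ^+ 2 * ay = ay ->
    ax * ay * (c * d) * (sx * (a / c) - sy * (b / d)) ^+ 2 =
    ax * c * (ay * (b ^+ 2 / d)) + ay * d * (ax * (a ^+ 2 / c))
    - 2 * (x * a * (y * b)).
  move=> c0 d0 -> -> ex ey; rewrite -{2}ey -{3}ex; field; exact/andP.
have sg2 x : Num.sg x ^+ 2 * `|x| = `|x| :> R.
  by rewrite sqr_sg; case: eqVneq => [->|_]; rewrite ?normr0 ?mulr0 ?mul1r.
exact: aux (p0 _) (p0 _) (numEsg _) (numEsg _) (sg2 _) (sg2 _).
Qed.

Let gap_term_ge0 (v : 'rV[R]_n) j i i' :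
  0 <= `|M j i| * `|M j i'| * (p i * p i') *
    (Num.sg (M j i) * (v 0 i / p i) - Num.sg (M j i') * (v 0 i' / p i')) ^+ 2.
Proof.
apply: mulr_ge0 (sqr_ge0 _); apply: mulr_ge0; apply: mulr_ge0; rewrite ?normr_ge0 //.
all: exact: ltW.
Qed.

Lemma schur_eigenvalue_le1 a : eigenvalue (M^T *m M) a -> a <= 1.
Proof.
move=> /eigenvalueP[v /gram_form va v0].
rewrite -(ler_pM2r (row_sqr_gt0 v0)) -va mul1r -subr_ge0 schur_gap.
rewrite addr_ge0 ?sumr_ge0 // => [i _|j _]; first exact: sqr_ge0.
by rewrite mulr_ge0 ?invr_ge0 // ?ler0n // sumr_ge0 // => i _; rewrite sumr_ge0.
Qed.

(** For an eigenvector of eigenvalue 1 the gap is zero, and being a sum of nonnegative terms it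
    vanishes term by term. *)
Lemma schur_eigen1P (v : 'rV[R]_n) :
  reflect
    ((forall i, (forall j, M j i = 0) -> v 0 i = 0) /\
     (forall j i i', M j i != 0 -> M j i' != 0 ->
       Num.sg (M j i) * (v 0 i / p i) = Num.sg (M j i') * (v 0 i' / p i')))
    (v <= eigenspace (M^T *m M) 1)%MS.
Proof.
have p0 i : p i != 0 by rewrite gt_eqF.
apply: (iffP eigenspaceP) => [/gram_form|[v0 vE]].
  move/eqP; rewrite mul1r eq_sym -subr_eq0 schur_gap paddr_eq0; first last.
  - apply: sumr_ge0 => j _; rewrite mulr_ge0 ?invr_ge0 ?ler0n // sumr_ge0 // => i _.
    by rewrite sumr_ge0.
  - by apply: sumr_ge0 => i _; exact: sqr_ge0.
  case/andP => /eqP s1 /eqP s2; split.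
    move=> i Mi0; apply/eqP; rewrite -sqrf_eq0; apply/eqP.
    apply: (psumr_eq0P _ s1) => [k _|]; first exact: sqr_ge0.
    by apply/forallP => j; rewrite Mi0.
  move=> j i i' Mi Mi'.
  have /eqP : 2^-1 * \sum_i \sum_i' `|M j i| * `|M j i'| * (p i * p i') *
    (Num.sg (M j i) * (v 0 i / p i) - Num.sg (M j i') * (v 0 i' / p i')) ^+ 2 = 0.
    apply: (psumr_eq0P _ s2) => // k _.
    by rewrite mulr_ge0 ?invr_ge0 ?ler0n // sumr_ge0 // => l _; rewrite sumr_ge0.
  rewrite mulf_eq0 invr_eq0 pnatr_eq0 /= => /eqP s3.
  have ge0 k : k \in predT -> 0 <= \sum_i' `|M j k| * `|M j i'| * (p k * p i') *
      (Num.sg (M j k) * (v 0 k / p k) - Num.sg (M j i') * (v 0 i' / p i')) ^+ 2.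
    by move=> _; rewrite sumr_ge0.
  have s4 := psumr_eq0P ge0 s3 (i := i) isT.
  have /eqP := psumr_eq0P (fun k _ => gap_term_ge0 v j i k) s4 (i := i') isT.
  rewrite !mulf_eq0 !normr_eq0 (negPf Mi) (negPf Mi') !(negPf (p0 _)) /=.
  by rewrite orbb subr_eq0 => /eqP.
(* Conversely, the sign relation turns each [M j i' * v 0 i'] into a multiple of [|M j i'| * p i']
   by a factor free of [i']. The row sum then yields [q j], and the column sum returns [v 0 i]. *)
rewrite scale1r; apply/rowP => i; rewrite mulmxA mxE.
case: (pselect (exists j, M j i != 0)) => [ex|nex]; last first.
  have M0 j : M j i = 0 by apply/eqP/negP => /negP Mj; apply: nex; exists j.
  by rewrite v0 // big1 // => j _; rewrite M0 mulr0.
transitivity (\sum_j `|M j i| * q j * (v 0 i / p i)); last first.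
  by rewrite -mulr_suml col_sum //; field.
apply: eq_bigr => j _; have [->|Mji] := eqVneq (M j i) 0.
  by rewrite normr0 mulr0 !mul0r.
rewrite -row_sum; last by exists i.
rewrite mxE mulr_suml mulr_sumr mulr_suml; apply: eq_bigr => i' _; rewrite mxE.
have [->|Mji'] := eqVneq (M j i') 0; first by rewrite normr0 mul0r !mulr0 !mul0r.
have sg2 : Num.sg (M j i) ^+ 2 = 1 by rewrite sqr_sg Mji.
have := congr1 ( *%R (Num.sg (M j i))) (vE j i i' Mji Mji').
rewrite mulrA -expr2 sg2 mul1r => ->.
by rewrite {1}[M j i]numEsg {1}[M j i']numEsg; field.
Qed.

End SchurTest.

(** * Oriented faces *)

Section Orientations.
Variable V : finType.

(** The value [true] reverses, as with [odd_perm] and exponents of -1, so that signs compose by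
    exclusive or. *)
Definition osign (k : nat) (b : bool) (o : oface V k) : oface V k :=
  if b then oopp o else o.

Lemma permuteM n (t : n.-tuple V) (p q : 'S_n) :
  permute (permute t p) q = permute t (q * p)%g.
Proof. by apply: eq_from_tnth => i; rewrite !tnth_mktuple permM. Qed.

Lemma permute1 n (t : n.-tuple V) : permute t 1%g = t.
Proof. by apply: eq_from_tnth => i; rewrite tnth_mktuple perm1. Qed.

Lemma permute_uniq n (t : n.-tuple V) p : uniq t -> uniq (permute t p).
Proof.
move=> /tuple_uniqP ut; apply/tuple_uniqP => i j.
by rewrite !tnth_mktuple => /ut /perm_inj.
Qed.

Lemma permute_set n (t : n.-tuple V) p : [set x in permute t p] = [set x in t].
Proof.
apply/setP => x; rewrite !inE; apply/tnthP/tnthP => -[i ->].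
  by exists (p i); rewrite tnth_mktuple.
by exists (p^-1%g i); rewrite tnth_mktuple permKV.
Qed.

Lemma odd_perm_exists m (b : bool) : exists p : 'S_m.+2, odd_perm p = b.
Proof.
case: b; last by exists 1%g; rewrite odd_perm1.
by exists (tperm ord0 ord_max); rewrite odd_tperm.
Qed.

(** The two orientations are the two cosets of the alternating group, selected by parity. *)
Lemma osign_classE m b (t : m.+2.-tuple V) :
  osign b (oclass t) = [set permute t p | p in [set p : 'S_m.+2 | odd_perm p == b]]
    :> {set m.+2.-tuple V}.
Proof.
case: b => /=; last
  by apply/setP => u; apply/imsetP/imsetP => -[p]; rewrite ?inE ?eqbF_neg => po ->;
     exists p; rewrite ?inE ?eqbF_neg.
apply/setP => u; apply/imset2P/imsetP => [[v q]|[p]].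
  move=> /imsetP[p]; rewrite !inE => pe -> qo ->; exists (q * p)%g; rewrite ?permuteM //.
  by rewrite inE odd_permM qo (negPf pe).
rewrite inE => /eqP po ->; exists t p => //; last by rewrite inE po.
by apply/imsetP; exists 1%g; rewrite ?permute1 // inE odd_perm1.
Qed.

Lemma oclass_permute k (t : k.+1.-tuple V) (p : 'S_k.+1) :
  oclass (permute t p) = osign (odd_perm p) (oclass t).
Proof.
case: k t p => [|m] t p.
  have -> : p = 1%g by apply/permP => i; rewrite !ord1.
  by rewrite permute1 odd_perm1.
rewrite -[LHS]/(osign false _) !osign_classE.
apply/setP => u; apply/imsetP/imsetP => -[q]; rewrite inE => /eqP qo ->.
  by exists (q * p)%g; rewrite ?permuteM // inE odd_permM qo.
exists (q * p^-1)%g; first by rewrite inE odd_permM odd_permV qo addbb.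
by rewrite permuteM mulgKV.
Qed.

Lemma osign_class_inj k b c (t u : k.+1.-tuple V) :
  osign b (oclass t) = osign c (oclass u) ->
  exists2 p : 'S_k.+1, u = permute t p & odd_perm p = b (+) c.
Proof.
case: k t u => [|m] t u.
  (* For a vertex there is only the identity permutation; the sign sits in the boolean component. *)
  move=> E; exists 1%g.
    rewrite permute1; apply: eq_from_tnth => i; rewrite ord1.
    by move: E; case: b c => [] []; rewrite /= => -[].
  by move: E; rewrite odd_perm1; case: b c => [] [] //= [].
rewrite !osign_classE => E.
have [q /eqP qo] := odd_perm_exists m c.
have : permute u q \in [set permute u p | p in [set p : 'S_m.+2 | odd_perm p == c]].
  by apply/imsetP; exists q; rewrite ?inE.
rewrite -E => /imsetP[p]; rewrite inE => /eqP po uE.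
exists (q^-1 * p)%g; first by rewrite -permuteM -uE permuteM mulVg permute1.
by rewrite odd_permM odd_permV po (eqP qo) addbC.
Qed.

Lemma osignM k b c (t : k.+1.-tuple V) :
  osign b (osign c (oclass t)) = osign (b (+) c) (oclass t).
Proof.
case: b c => [] [] //; case: k t => [|m] t //.
(* What remains is a double reversal in positive dimension; the inner reversal is realised by an odd
   reordering of [t]. *)
have [p po] := odd_perm_exists m true.
have -> : osign true (oclass t) = oclass (permute t p) by rewrite oclass_permute po.
rewrite !osign_classE; apply/setP => u.
apply/imsetP/imsetP => -[q]; rewrite inE => /eqP qo ->.
  by exists (q * p)%g; rewrite ?permuteM // inE odd_permM qo po.
exists (q * p^-1)%g; first by rewrite inE odd_permM odd_permV qo po.
by rewrite permuteM mulgKV.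
Qed.

Lemma same_support_permute n (t u : n.-tuple V) : uniq t -> uniq u ->
  [set x in t] = [set x in u] -> exists p : 'S_n, u = permute t p.
Proof.
move=> ut uu E.
have /tuple_permP[p pE] : perm_eq u t.
  by apply: uniq_perm => // x; have /setP/(_ x) := E; rewrite !inE.
by exists p; apply: val_inj; exact: pE.
Qed.

Lemma oriented_overP k (o : oface V k) (s : {set V}) :
  reflect (exists (t : k.+1.-tuple V) (b : bool),
    [/\ uniq t, [set x in t] = s & o = osign b (oclass t)]) (oriented_over o s).
Proof.
apply: (iffP existsP) => [[t /and3P[ut /eqP ts /orP[]/eqP ->]]|[t [b [ut ts ->]]]].
- by exists t, false.
- by exists t, true.
- by exists t; rewrite ut ts eqxx /=; case: b; rewrite eqxx ?orbT.
Qed.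

Lemma oriented_over_osign k b (o : oface V k) (s : {set V}) :
  oriented_over o s -> oriented_over (osign b o) s.
Proof.
move=> /oriented_overP[t [c [ut ts ->]]]; apply/oriented_overP.
by exists t, (b (+) c); rewrite osignM.
Qed.

Lemma oriented_over_unique k (o o' : oface V k) (s : {set V}) :
  oriented_over o s -> oriented_over o' s -> exists b, o' = osign b o.
Proof.
move=> /oriented_overP[t [b [ut ts ->]]] /oriented_overP[u [c [uu us ->]]].
have [p ->] : exists p, u = permute t p by apply: same_support_permute; rewrite ?ts.
by exists ((odd_perm p (+) c) (+) b); rewrite oclass_permute !osignM addbK addbC.
Qed.

(** Removing [i] from the source and [p i] from the target leaves an injective map, hence a
    permutation. In this form [odd_lift_perm] computes the parity. *)
Lemma lift_perm_exists n (p : 'S_n.+1) (i : 'I_n.+1) :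
  exists s : 'S_n, p = lift_perm i (p i) s.
Proof.
have inj : injective (fun j => odflt j (unlift (p i) (p (lift i j)))).
  move=> j j'.
  have neq l : p i != p (lift i l) by rewrite (inj_eq perm_inj) neq_lift.
  case: (unlift_some (neq j)) => a pa ->; case: (unlift_some (neq j')) => a' pa' -> /=.
  by move=> aa'; apply: (@lift_inj _ i); apply: (@perm_inj _ p); rewrite pa pa' aa'.
exists (perm inj); apply/permP => l.
case: (unliftP i l) => [j ->|->]; last by rewrite lift_perm_id.
rewrite lift_perm_lift permE.
have neq : p i != p (lift i j) by rewrite (inj_eq perm_inj) neq_lift.
by case: (unlift_some neq) => a pa ->.
Qed.

(** This is the sign rule of cofactor expansion: reordering a face by [p] reorders a facet with
    parity changed by the old and the new position of the omitted vertex. *)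
Lemma del_permute k (t : k.+2.-tuple V) (p : 'S_k.+2) (i : 'I_k.+2) :
  exists2 s : 'S_k.+1, del (permute t p) i = permute (del t (p i)) s &
    odd_perm s = odd_perm p (+) odd i (+) odd (p i).
Proof.
have [s sE] := lift_perm_exists p i; exists s.
  apply: eq_from_tnth => j; rewrite !tnth_mktuple; congr tnth.
  by rewrite {1}sE lift_perm_lift.
by rewrite {1}sE odd_lift_perm; case: odd; case: odd; case: odd_perm.
Qed.

Lemma del_set k (t : k.+2.-tuple V) i : uniq t ->
  [set x in del t i] = [set x in t] :\ tnth t i.
Proof.
move=> /tuple_uniqP ut; apply/setP => x; rewrite !inE.
apply/tnthP/andP => [[j ->]|[xi /tnthP[l xl]]].
  by rewrite tnth_mktuple mem_tnth (inj_eq ut) eq_sym neq_lift.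
rewrite xl (inj_eq ut) eq_sym in xi; have [j lj _] := unlift_some xi.
by exists j; rewrite tnth_mktuple -lj.
Qed.

Lemma del_uniq k (t : k.+2.-tuple V) i : uniq t -> uniq (del t i).
Proof.
move=> /tuple_uniqP ut; apply/tuple_uniqP => j j'.
by rewrite !tnth_mktuple => /ut /lift_inj.
Qed.

(** The existential in [inc] may be witnessed by another ordering of the same oriented face and
    another index. Such an ordering differs from [t] by an even permutation, and [del_permute] shows
    that the sign obtained is the same. *)
Lemma inc_class k b (t : k.+2.-tuple V) i : uniq t ->
  inc (oclass t) (osign b (oclass (del t i))) = (-1) ^+ (b (+) odd i).
Proof.
move=> ut; rewrite /inc.
set ex := [exists _, _]; suff -> : ex = ~~ (b (+) odd i) by case: (b (+) odd i).
rewrite {}/ex; apply/existsP/idP => [[u /existsP[j /andP[/eqP tu /eqP dE]]]|bi]; last first.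
  exists t; apply/existsP; exists i; rewrite eqxx.
  by move: bi; case: b; case: (odd i); rewrite /= ?eqxx.
have [p uE pe] := @osign_class_inj _ false false _ _ tu.
rewrite -[if _ then _ else _]/(osign _ _) in dE.
have [s delE so] := del_permute t p j.
move: dE; rewrite uE delE oclass_permute osignM so pe /= addbA addbb /=.
move=> /osign_class_inj[r rE ro].
(* The vertex missing from [del t i] determines the omitted position. *)
have ij : i = p j.
  have := permute_set (del t i) r; rewrite -rE !del_set // => /setP/(_ (tnth t i)).
  rewrite !inE eqxx mem_tnth andbT /= => /negbFE /eqP; exact: (tuple_uniqP _ ut).
(* Only the identity fixes a tuple without repetitions. *)
have r1 : r = 1%g.
  move: rE; rewrite -ij => rE; apply/permP => l; rewrite perm1.
  have /(congr1 (fun w => tnth w l)) := rE; rewrite [RHS]tnth_mktuple => E.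
  by apply: (tuple_uniqP _ (del_uniq i ut)); exact: esym E.
by move: ro; rewrite r1 odd_perm1 ij => <-.
Qed.

(** Up to signs, the two faces are an ordering [u] and [u] with one entry deleted. The formula
    [base] for such pairs makes the dependence on both signs explicit. *)
Lemma inc_osign k b c (q : oface V k.+1) (o : oface V k) (t s : {set V}) :
  oriented_over q t -> oriented_over o s -> s \subset t ->
  inc (osign b q) (osign c o) = (-1) ^+ (b (+) c) * inc q o.
Proof.
suff base b' c' (u : k.+2.-tuple V) i : uniq u ->
    inc (osign b' (oclass u)) (osign c' (oclass (del u i))) = (-1) ^+ (b' (+) c' (+) odd i).
  move=> /oriented_overP[u [b' [uu us ->]]] /oriented_overP[v [c' [uv vs ->]]] st.
  have [i [d ->]] : exists i d, oclass v = osign d (oclass (del u i)).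
    have cs : #|s| = k.+1 by rewrite -vs cardsE (card_uniqP uv) size_tuple.
    have ct : #|t| = k.+2 by rewrite -us cardsE (card_uniqP uu) size_tuple.
    have /cards1P[x tsx] : #|t :\: s| == 1%N.
      by rewrite cardsD (setIidPr st) cs ct subSnn.
    have xt : x \in t by have := set11 x; rewrite -tsx inE => /andP[].
    have /tnthP[i xi] : x \in u by move: xt; rewrite -us inE.
    have [|p vE] := @same_support_permute _ (del u i) v (del_uniq i uu) uv.
      rewrite del_set // us vs -xi -tsx; apply/setP => y; rewrite !inE.
      by have /subsetP/(_ y) := st; case: (y \in s) => [-> //|_]; case: (y \in t).
    by exists i, (odd_perm p); rewrite vE oclass_permute.
  rewrite !osignM !base // -signr_addb; congr (_ ^+ _).
  by case: b; case: c; case: b'; case: c'; case: d; case: (odd i).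
(* The sign [b'] is absorbed into a reordering of [u]; the vertex at position [i] then stands at
   position [p^-1%g i]. *)
move=> uu; have [p po] := odd_perm_exists k b'.
have -> : osign b' (oclass u) = oclass (permute u p) by rewrite oclass_permute po.
have := @del_permute _ u p (p^-1%g i); rewrite permKV => -[r dE ro].
have -> : osign c' (oclass (del u i)) =
    osign (c' (+) odd_perm r) (oclass (del (permute u p) (p^-1%g i))).
  by rewrite dE oclass_permute osignM addbK.
rewrite inc_class ?permute_uniq // ro po; congr (_ ^+ nat_of_bool _).
by rewrite -!addbA [odd i (+) _]addbC addKb !addbA [b' (+) c']addbC.
Qed.

End Orientations.

(** * Components and the eigenvalue 1 *)

Section Components.
Variables (V : finType) (D : {set {set V}}) (e : rel {set V}).
Hypothesis e_sym : symmetric e.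
Hypothesis e_dom : forall x y, e x y -> y \in D.

(** A connectivity class is connected and contains every connected set through any of its points, so
    the classes of points of [D] are exactly the maximal connected sets. *)
Lemma componentP (C : {set {set V}}) :
  reflect (exists2 x, x \in D & C = [set y | connect e x y]) (component e D C).
Proof.
have csym : connect_sym e by apply: sym_connect_sym.
have clD x : x \in D -> [set y | connect e x y] \subset D.
  move=> xD; apply/subsetP => y; rewrite inE => /connectP[r rp ->].
  by elim: r x xD rp => //= z r IHr x xD /andP[/e_dom zD]; apply: IHr.
have clC x : connected_set e [set y | connect e x y].
  apply/forall_inP => y; rewrite inE => xy; apply/forall_inP => z; rewrite inE => xz.
  have /connectP[r rp ->] : connect e y z by rewrite (connect_trans _ xz) // csym.
  (* Every point on a path from [y] is again connected to [x], so the path stays inside the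
     class. *)
  elim: r y xy rp => //= u r IHr y xy /andP[yu ru].
  have xu : connect e x u by rewrite (connect_trans xy) // connect1.
  by apply: (@connect_trans _ _ u); rewrite ?IHr // connect1 //= !inE xy xu.
have subcl (B : {set {set V}}) x : x \in B -> connected_set e B ->
    B \subset [set y | connect e x y].
  move=> xB /forall_inP/(_ x xB)/forall_inP cB; apply/subsetP => y yB; rewrite inE.
  by apply: connect_sub (cB y yB) => u w /and3P[_ _]; apply: connect1.
apply: (iffP maxsetP) => [[/and3P[/set0Pn[x xC] CD cC] Cmax]|[x xD ->]].
  exists x; first exact: (subsetP CD).
  apply/esym/Cmax; last exact: subcl.
  by rewrite clC clD ?(subsetP CD) // !andbT; apply/set0Pn; exists x; rewrite inE.
split; first by rewrite clC clD // !andbT; apply/set0Pn; exists x; rewrite inE.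
move=> B /and3P[_ _ cB] clB; apply/eqP; rewrite eqEsubset clB andbT.
by apply: subcl => //; apply: (subsetP clB); rewrite inE.
Qed.

End Components.

(** * The 1-eigenspace of a signed incidence matrix satisfying the Schur conditions *)

Section BalancedComponents.
Variables (R : realFieldType) (V : finType) (D E : {set {set V}}).
Variables (M : 'M[R]_(#|E|, #|D|)) (p : 'I_#|D| -> R) (q : 'I_#|E| -> R).
Hypothesis p_gt0 : forall i, 0 < p i.
Hypothesis row_sum : forall j, (exists i, M j i != 0) -> \sum_i `|M j i| * p i = q j.
Hypothesis col_sum : forall i, (exists j, M j i != 0) -> \sum_j `|M j i| * q j = p i.
Variables (I : rel {set V}) (eps : {set V} -> {set V} -> R).
Hypothesis eps_sqr : forall t x, eps t x ^+ 2 = 1.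
Hypothesis sg_M : forall j i,
  Num.sg (M j i) = if I (enum_val j) (enum_val i) then eps (enum_val j) (enum_val i) else 0.
Variable e : rel {set V}.
Hypothesis eE : forall x y,
  e x y = [&& x \in D, y \in D, x != y & [exists t in E, I t x && I t y]].

(** The function [s] says which elements to reorient, as in switching a signed graph. This abstract
    form of coherence covers the up and the down case. *)
Definition balanced (C : {set {set V}}) : Prop :=
  exists s : {set V} -> bool, forall x y t, x \in C -> y \in C -> t \in E ->
    I t x -> I t y -> eps t x * (-1) ^+ s x = eps t y * (-1) ^+ s y.

Let eps_neq0 t x : eps t x != 0.
Proof. by rewrite -sqrf_eq0 eps_sqr oner_eq0. Qed.

Let M_neq0 j i : (M j i != 0) = I (enum_val j) (enum_val i).
Proof.
rewrite -sgr_eq0 sg_M; case: ifP => _; first exact: eps_neq0.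
by rewrite eqxx.
Qed.

Let e_sym : symmetric e.
Proof.
move=> x y; rewrite !eE andbCA eq_sym; congr [&& _, _, _ & _].
by apply: eq_existsb => t; rewrite [I t x && _]andbC.
Qed.

Let e_dom x y : e x y -> y \in D.
Proof. by rewrite eE => /and4P[]. Qed.

(** The ratio [v / p] as a function on all sets: the sum has a single term on [D] and is empty
    elsewhere. *)
Let pot (v : 'rV[R]_#|D|) (x : {set V}) : R :=
  \sum_(i | enum_val i == x) v 0 i / p i.

Let pot_val v i : pot v (enum_val i) = v 0 i / p i.
Proof.
rewrite /pot (big_pred1 i) // => j; rewrite /= (inj_eq enum_val_inj) //.
Qed.

Let in_enum (A : {set {set V}}) x : x \in A -> exists i : 'I_#|A|, x = enum_val i.
Proof. by move=> xA; exists (enum_rank_in xA x); rewrite enum_rankK_in. Qed.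

Let eigen_potP (v : 'rV[R]_#|D|) :
  (v <= eigenspace (M^T *m M) 1)%MS <->
  (forall x, x \in D -> ~~ [exists t in E, I t x] -> pot v x = 0) /\
  (forall x y t, x \in D -> y \in D -> t \in E -> I t x -> I t y ->
     eps t x * pot v x = eps t y * pot v y).
Proof.
split=> [/(schur_eigen1P p_gt0 row_sum col_sum)[v0 vE]|[v0 vE]].
  split=> [x /in_enum[i ->] nI|x y t /in_enum[i ->] /in_enum[i' ->] /in_enum[j ->] It It'].
    rewrite pot_val v0 ?mul0r // => j; apply/eqP; apply: contraNT nI.
    rewrite M_neq0 => Ij; apply/existsP; exists (enum_val j).
    by rewrite enum_valP.
  by have := vE j i i'; rewrite !M_neq0 !sg_M It It' !pot_val; apply.
apply/(schur_eigen1P p_gt0 row_sum col_sum); split=> [i Mi0|j i i'].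
  have : pot v (enum_val i) = 0.
    apply: v0; first exact: enum_valP.
    by apply/existsP => -[t /andP[/in_enum[j ->]]]; rewrite -M_neq0 Mi0 eqxx.
  by move/eqP; rewrite pot_val mulf_eq0 invr_eq0 (gt_eqF (p_gt0 i)) orbF => /eqP.
rewrite !M_neq0 !sg_M => It It'; rewrite It It' -!pot_val.
by apply: vE => //; apply: enum_valP.
Qed.

Lemma rank_eigenspace_balanced (K : {set {set {set V}}}) :
  (forall C, C \in K <-> [/\ component e D C,
     exists2 x, x \in C & [exists t in E, I t x] & balanced C]) ->
  \rank (eigenspace (M^T *m M) 1) = #|K|.
Proof.
move=> KP.
(* Adjacent elements both have incidences, so one incident element of a component makes all of them
   incident. *)
have adjI : closed e [pred x | [exists t in E, I t x]].
  move=> x y; rewrite eE => /and4P[_ _ _ /existsP[t /and3P[tE Ix Iy]]]; rewrite !inE.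
  by transitivity true; [apply/existsP|apply/esym/existsP]; exists t; rewrite tE ?Ix ?Iy.
have classD x : x \in D -> forall y, connect e x y -> y \in D.
  have cl : closed e D by move=> a b; rewrite eE => /and3P[-> ->].
  by move=> xD y /(closed_connect cl) <-.
have csym : connect_sym e by apply: sym_connect_sym.
have KE C x : C \in K -> x \in C -> C = [set y | connect e x y].
  move=> /KP[/(componentP e_sym e_dom)[z zD ->] _ _]; rewrite inE => zx.
  by apply/setP => y; rewrite !inE (same_connect csym zx).
have KD C x : C \in K -> x \in C -> x \in D.
  move=> /KP[/(componentP e_sym e_dom)[z zD ->] _ _]; rewrite inE; exact: classD.
have KI C x : C \in K -> x \in C -> [exists t in E, I t x].
  move=> CK xC; have /KP[_ [z zC zI] _] := CK.
  move: xC; rewrite (KE C z CK zC) inE => /(closed_connect adjI); rewrite !inE zI => <- //.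
have /choice[s sP] : forall C, exists s : {set V} -> bool, C \in K ->
    forall x y t, x \in C -> y \in C -> t \in E ->
    I t x -> I t y -> eps t x * (-1) ^+ s x = eps t y * (-1) ^+ s y.
  move=> C; have [CK|] := boolP (C \in K); last by exists xpredT.
  by have /KP[_ _ [s sP]] := CK; exists s.
have sgn2 (b : bool) : (-1) ^+ b * (-1) ^+ b = 1 :> R by rewrite -signr_addb addbb.
(* The basis vector of [C] has as its ratio to [p] the balancing sign on [C], and 0 outside. *)
pose b (C : {set {set V}}) (i : 'I_#|D|) : R :=
  if enum_val i \in C then (-1) ^+ s C (enum_val i) * p i else 0.
apply: (@rank_disjoint_rows _ _ _ _ _ _ b).
- move=> C CK; have /KP[_ [x xC _] _] := CK.
  have [i xi] := in_enum (KD _ _ CK xC); exists i.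
  by rewrite /b -xi xC mulf_neq0 ?signr_eq0 // gt_eqF.
- move=> C C' i CK C'K; rewrite /b; case: ifP => [iC _|]; last by rewrite eqxx.
  case: ifP => [iC' _|]; last by rewrite eqxx.
  by rewrite (KE _ _ CK iC) (KE _ _ C'K iC').
- move=> C CK; set v := \row_i _.
  have potE x : x \in D -> pot v x = if x \in C then (-1) ^+ s C x else 0.
    move=> /in_enum[i ->]; rewrite pot_val mxE /b; case: ifP => _; rewrite ?mul0r //.
    by rewrite mulfK // gt_eqF.
  apply/eigen_potP; split=> [x xD nI|x y t xD yD tE Ix Iy].
    by rewrite potE //; case: ifP => // xC; rewrite (KI C) in nI.
  rewrite !potE //.
  have [<-//|xy] := eqVneq x y.
  have exy : connect e x y.
    apply: connect1; rewrite eE xD yD xy; apply/existsP; exists t.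
    by rewrite tE Ix Iy.
  have -> : (y \in C) = (x \in C).
    apply/idP/idP => zC; rewrite (KE _ _ CK zC) inE // csym //.
  by case: ifP => [xC|_]; rewrite ?mulr0 //; apply: sP => //;
     rewrite (KE _ _ CK xC) inE.
- move=> v /eigen_potP[v0 vE].
  have step x y : e x y -> exists2 c : R, c ^+ 2 = 1 & pot v x = c * pot v y.
    rewrite eE => /and4P[xD yD _ /existsP[t /and3P[tE Ix Iy]]].
    exists (eps t x * eps t y); first by rewrite exprMn !eps_sqr mulr1.
    by rewrite -mulrA -(vE x y t) // mulrA -expr2 eps_sqr mul1r.
  have absE x y : connect e x y -> `|pot v x| = `|pot v y|.
    have cl : closed e [pred z | `|pot v z| == `|pot v x|].
      move=> z w /step[c c1 zw]; rewrite !inE zw normrM.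
      by move/eqP: c1; rewrite sqr_norm_eq1 => /eqP ->; rewrite mul1r.
    by move=> /(closed_connect cl); rewrite !inE eqxx => /esym/eqP.
  (* If [v] does not vanish at [x], its signs balance the class of [x]: the common absolute value
     cancels from the eigenvector relation. *)
  have outK x : x \in D -> pot v x != 0 -> [set y | connect e x y] \in K.
    move=> xD vx; apply/KP; split.
    - by apply/(componentP e_sym e_dom); exists x.
    - by exists x; rewrite ?inE //; apply: contraNT vx => /v0 ->.
    - exists (fun y => pot v y < 0) => y z t; rewrite !inE => xy xz tE Iy Iz.
      have := vE y z t (classD _ xD _ xy) (classD _ xD _ xz) tE Iy Iz.
      rewrite {1}[pot v y]realEsign ?num_real // {1}[pot v z]realEsign ?num_real //.
      rewrite -(absE _ _ xy) -(absE _ _ xz) !mulrA.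
      by apply: mulIf; rewrite normr_eq0.
  (* After correction by the balancing signs the potential is constant on [C]; this constant is the
     coordinate of [v] along [b C]. *)
  have inK C x y : C \in K -> x \in C -> y \in C ->
      (-1) ^+ s C x * pot v x = (-1) ^+ s C y * pot v y.
    move=> CK xC yC.
    have cl : closed e [pred z | (z \in C) &&
        ((-1) ^+ s C z * pot v z == (-1) ^+ s C x * pot v x)].
      move=> z w zw; rewrite !inE.
      have zwC : (z \in C) = (w \in C).
        by apply/idP/idP => aC; rewrite (KE _ _ CK aC) inE connect1 // e_sym.
      rewrite -zwC; case: (boolP (z \in C)) => //= zC; rewrite zwC in (wC := zC).
      move: zw; rewrite eE => /and4P[zD wD _ /existsP[t /and3P[tE Iz Iw]]].
      have vzw := vE _ _ _ zD wD tE Iz Iw.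
      have szw := sP C CK _ _ _ zC wC tE Iz Iw.
      (* Of the two factors [eps t z], one is used with the balance relation and the other with the
         eigenvector relation. *)
      congr (_ == _); apply: (mulfI (eps_neq0 t z)); apply: (mulfI (eps_neq0 t z)).
      rewrite mulrA mulrACA szw vzw mulrACA.
      by rewrite [RHS]mulrA -!expr2 !eps_sqr.
    move: (yC); rewrite {1}(KE _ _ CK xC) inE => /(closed_connect cl).
    by rewrite !inE xC eqxx yC /= => /esym/eqP.
  exists (fun C : {set {set V}} =>
    if [pick x in C] is Some x then (-1) ^+ s C x * pot v x else 0) => i.
  have vi : v 0 i = pot v (enum_val i) * p i by rewrite pot_val divfK // gt_eqF.
  have [v0i|vi0] := eqVneq (pot v (enum_val i)) 0.
    rewrite vi v0i mul0r big1 // => C CK; rewrite /b; case: ifP => iC; rewrite ?mulr0 //.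
    case: pickP => [x xC|/(_ (enum_val i))]; last by rewrite iC.
    by rewrite (inK C x _ CK xC iC) v0i mulr0 mul0r.
  have CK := outK _ (enum_valP i) vi0; set C := [set _ | _] in CK.
  have iC : enum_val i \in C by rewrite inE.
  rewrite (bigD1 C) //= big1 => [|C' /andP[C'K C'C]].
    rewrite addr0 /b iC; case: pickP => [x xC|/(_ (enum_val i))]; last by rewrite iC.
    by rewrite (inK C x _ CK xC iC) mulrACA sgn2 mul1r vi.
  rewrite /b; case: ifP => iC'; rewrite ?mulr0 //.
  by move: C'C; rewrite (KE _ _ C'K iC') eqxx.
Qed.

End BalancedComponents.

(** * Simplicial complexes *)

Lemma sym_lambda_max (R : realType) n (A : 'M[R]_n) :
  A^T = A -> (0 < n)%N -> exists l, is_lambda_max A l.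
Proof.
move=> symA n0; have [d dP] := sym_eigenvalues symA.
have [i _ imax] := @arg_maxP _ _ _ (Ordinal n0) xpredT d isT.
exists (d i); split; first by apply/dP; exists i.
by move=> a /dP[j ->]; exact: imax.
Qed.

Section Faces.
Variables (R : realType) (V : finType) (X : scomplex V).
Implicit Types (k : nat) (s t : {set V}).

Lemma kfacesP k s : reflect (s \in X /\ #|s| = k.+1) (s \in kfaces X k).
Proof. by rewrite inE; apply: (iffP andP) => -[sX /eqP]. Qed.

Lemma face_sub s t : t \in X -> s \subset t -> s != set0 -> s \in X.
Proof. by case: X => F ? ? H /= ; apply: H. Qed.

Lemma nonleaf_cofacet s : s \in X -> ~~ leaf X s ->
  exists2 t, t \in X & (s \subset t) && (#|t| == #|s|.+1).
Proof.
rewrite /leaf => sX; rewrite sX /= negbK => /existsP[t /and3P[tX st /subsetPn[x xt xs]]].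
exists (x |: s); last by rewrite subsetUr cardsU1 xs eqxx.
apply: (face_sub tX); first by rewrite subUset sub1set xt st.
by apply/set0Pn; exists x; rewrite setU11.
Qed.

Lemma proper_nonleaf s t : t \in X -> s \subset t -> (#|s| < #|t|)%N -> ~~ leaf X s.
Proof.
move=> tX st c; rewrite /leaf negb_and negbK; apply/orP; right.
by apply/existsP; exists t; rewrite tX properEcard st.
Qed.

Lemma LP_gt0 s : s \in X -> (0 < LP X s)%N.
Proof.
move En : (#|V| - #|s|)%N => n; elim: n s En => [|n IHn] s En sX.
all: have [/LP_leaf ->//|ns] := boolP (leaf X s); rewrite LP_nonleaf //.
all: have [t tX /[dup] tP /andP[_ /eqP ct]] := nonleaf_cofacet sX ns.
  (* When [s] already has [#|V|] elements, a cofacet would have too many. *)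
  by have := max_card (mem t); rewrite ct ltnNge -subn_eq0 En.
rewrite (bigD1 t) ?tX //= ltn_addr // IHn // ct.
by rewrite subnS En.
Qed.

Lemma wt_gt0 s : s \in X -> 0 < wt R X s.
Proof. by move=> sX; rewrite divr_gt0 ?ltr0n ?LP_gt0 ?fact_gt0. Qed.

Lemma kface_wt_gt0 k (i : 'I_#|kfaces X k|) : 0 < wt R X (kface i).
Proof. by have /kfacesP[sX _] := enum_valP i; exact: wt_gt0. Qed.

Lemma sqrt_kface_wt_gt0 k (i : 'I_#|kfaces X k|) : 0 < Num.sqrt (wt R X (kface i)).
Proof. by rewrite sqrtr_gt0 kface_wt_gt0. Qed.

Lemma card_facets k t : t \in kfaces X k.+1 ->
  #|[set s in kfaces X k | s \subset t]| = k.+2.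
Proof.
move=> /kfacesP[tX ct].
have -> : [set s in kfaces X k | s \subset t] =
    [set s : {set V} | s \subset t & #|s| == k.+1].
  apply/setP => s; rewrite !inE andbC; have [st|] //= := boolP (s \subset t).
  have [cs|] := boolP (#|s| == k.+1); rewrite ?andbF // (face_sub tX) //.
  by rewrite -card_gt0 (eqP cs).
by rewrite cards_draws ct binSn.
Qed.

(** The recursion for [LP] combined with [(k.+2)! = k.+2 * (k.+1)!]. It is the source of the column
    sums in the Schur test. *)
Lemma sum_cofacets_wt k s : s \in kfaces X k -> ~~ leaf X s ->
  (k.+2)%:R * \sum_(t in kfaces X k.+1 | s \subset t) wt R X t = wt R X s.
Proof.
move=> /kfacesP[sX cs] ns; rewrite /wt LP_nonleaf // cs natr_sum mulr_suml mulr_sumr.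
apply: eq_big => [t|t].
  by rewrite inE -andbA; congr (_ && _); rewrite andbC.
rewrite inE => /andP[/andP[_ /eqP ->] _]; rewrite [k.+2`!]factS natrM invfM mulrCA.
by rewrite mulVKf // pnatr_eq0.
Qed.

(** The dimension bound provides a face with more than [k] elements, and any of its subsets with
    [k.+1] elements is a [k]-face. *)
Lemma kfaces_card_gt0 k : k%:Z <= sdim X -> (0 < #|kfaces X k|)%N.
Proof.
rewrite /sdim lerBrDr -PoszD lez_nat addn1 => km.
have [s sX ks] : exists2 s, s \in X & (k < #|s|)%N.
  apply/exists_inP; apply: contraLR km; rewrite negb_exists_in -leqNgt => /forall_inP H.
  by apply/bigmax_leqP => s sX; rewrite leqNgt; apply: H.
have : (0 < #|[set B : {set V} | B \subset s & #|B| == k.+1]|)%N.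
  by rewrite cards_draws bin_gt0.
move=> /card_gt0P[B]; rewrite inE => /andP[Bs cB].
apply/card_gt0P; exists B; rewrite inE cB andbT (face_sub sX) //.
by rewrite -card_gt0 (eqP cB).
Qed.

Lemma kfaces_pred_card_gt0 k : (0 < #|kfaces X k.+1|)%N -> (0 < #|kfaces X k|)%N.
Proof.
move=> /card_gt0P[t /card_facets c]; apply/card_gt0P.
have /card_gt0P[s] : (0 < #|[set s in kfaces X k | s \subset t]|)%N by rewrite c.
by rewrite inE => /andP[sk _]; exists s.
Qed.

(** By cardinality, a [(k+1)]-face containing two distinct [k]-faces is their union. This gives
    adjacency the incidence form used for balanced components. *)
Lemma up_adjE k s t : up_adj X k s t =
  [&& s \in kfaces X k, t \in kfaces X k, s != t &
      [exists u in kfaces X k.+1, (s \subset u) && (t \subset u)]].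
Proof.
rewrite /up_adj.
have [/kfacesP[sX cs]|//] := boolP (s \in kfaces X k).
have [/kfacesP[tX ct]|//] := boolP (t \in kfaces X k).
have [//|st] /= := eqVneq s t; apply/idP/existsP => [stk|[u /and3P[uk su tu]]].
  by exists (s :|: t); rewrite stk subsetUl subsetUr.
suff -> : s :|: t = u by [].
apply/eqP; rewrite eqEcard subUset su tu /=; have /kfacesP[_ ->] := uk.
rewrite ltnNge -{1}cs; apply: contra st => c.
have /eqP sE : s == s :|: t by rewrite eqEcard subsetUl c.
by rewrite eq_sym eqEcard cs ct leqnn andbT sE subsetUr.
Qed.

Lemma down_adjE k s t : down_adj X k.+1 s t =
  [&& s \in kfaces X k.+1, t \in kfaces X k.+1, s != t &
      [exists r in kfaces X k, (r \subset s) && (r \subset t)]].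
Proof.
rewrite /down_adj.
have [/kfacesP[sX cs]|//] := boolP (s \in kfaces X k.+1).
have [/kfacesP[tX ct]|//] := boolP (t \in kfaces X k.+1).
have [//|st] /= := eqVneq s t; apply/andP/existsP => [[iX ci]|[r /and3P[rk rs rt]]].
  by exists (s :&: t); rewrite subsetIl subsetIr inE iX ci.
suff -> : s :&: t = r by have /kfacesP[-> ->] := rk.
apply/eqP; rewrite eq_sym eqEcard subsetI rs rt /=; have /kfacesP[_ ->] := rk.
rewrite leqNgt; apply: contra st => c.
have /eqP sE : s :&: t == s by rewrite eqEcard subsetIl cs.
by rewrite eqEcard cs ct leqnn andbT -sE subsetIr.
Qed.

End Faces.

(** * The weighted coboundary matrix and its row and column sums *)

Section Delta.
Variables (R : realType) (V : finType) (X : scomplex V) (O : orientation X).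
Implicit Types (k : nat) (s t : {set V}).

Lemma orientP (O' : orientation X) k s :
  s \in kfaces X k -> oriented_over (O' k s) s.
Proof. by case: O' => o H /=; apply: H. Qed.

Lemma inc_sqr k (q : oface V k.+1) (o : oface V k) : inc q o ^+ 2 = 1.
Proof. by rewrite /inc; case: ifP => _; rewrite ?sqrrN expr1n. Qed.

Lemma W_halfE k : W_half R X k = diag_mx (\row_i Num.sqrt (wt R X (kface i))).
Proof.
by apply/matrixP => i j; rewrite !mxE; case: eqP => _; rewrite ?mulr1n // mulr0n sqrtr0.
Qed.

Lemma W_neghalfE k :
  W_neghalf R X k = diag_mx (\row_i (Num.sqrt (wt R X (kface i)))^-1).
Proof.
rewrite /W_neghalf W_halfE.
set A := diag_mx _; set B := diag_mx _.
have AB : A *m B = 1%:M.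
  rewrite mul_diag_mx; apply/matrixP => i j; rewrite !mxE.
  case: eqP => [->|_]; last by rewrite !mulr0n mulr0.
  by rewrite !mulr1n mulfV // gt_eqF ?sqrt_kface_wt_gt0.
have [Au _] := mulmx1_unit AB.
by rewrite -[RHS]mul1mx -(mulVmx Au) -mulmxA AB mulmx1.
Qed.

Lemma deltaE k : delta R O k = deltaO R O k.
Proof.
rewrite /delta W_halfE W_neghalfE mul_diag_mx mul_mx_diag.
apply/matrixP => i j; rewrite !mxE /=; case: ifP => _; last by rewrite mulr0 mul0r.
by congr (_ * _); rewrite mulrC.
Qed.

Lemma Lap_upE k : Lap_up R O k = - A_up R O k.
Proof.
apply/matrixP => i j; rewrite /Lap_up deltaE !mxE /=.
pose F (t : {set V}) := if (kface i \subset t) && (kface j \subset t) then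
   (Num.sqrt (wt R X (kface i)))^-1 * (Num.sqrt (wt R X (kface j)))^-1 *
    ((inc (O k.+1 t) (O k (kface i)))%:~R * (inc (O k.+1 t) (O k (kface j)))%:~R * wt R X t)
  else 0.
transitivity (\sum_(t in kfaces X k.+1) F t).
  rewrite [RHS]big_enum_val; apply: eq_bigr => l _; rewrite !mxE /F -/(kface l) /=.
  case: ifP => _; last by rewrite mul0r.
  case: ifP => _; last by rewrite mulr0.
  by rewrite -[X in _ = _ * (_ * X)](sqr_sqrtr (ltW (kface_wt_gt0 R l))); ring.
rewrite -big_mkcondr /= -mulr_sumr; case: ifPn => [_|]; first by rewrite opprK.
(* When [sim_up] fails there is no common cofacet: distinct faces are excluded directly, and equal
   ones because a leaf has no cofacet. *)
rewrite /sim_up negb_or => /andP[nsim nleaf]; rewrite oppr0.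
rewrite big_pred0 ?mulr0 // => t; apply/negP => /and3P[tk it jt].
have [ij|nij] := eqVneq (kface i) (kface j).
  move: nleaf; rewrite ij eqxx /= negbK; apply/negP.
  have /kfacesP[tX ct] := tk; have /kfacesP[_ cj] := enum_valP j.
  by apply: (proper_nonleaf tX jt); rewrite ct /kface cj.
move: nsim; rewrite nij /= => /existsP; apply; exists t; by rewrite tk it jt.
Qed.

Lemma Lap_downE k : Lap_down R O k = - A_down R O k.
Proof.
case: k => [|k]; first by rewrite oppr0.
apply/matrixP => i j; rewrite /Lap_down deltaE !mxE /=.
pose F (r : {set V}) := if (r \subset kface i) && (r \subset kface j) then
   Num.sqrt (wt R X (kface i)) * Num.sqrt (wt R X (kface j)) *
    ((inc (O k.+1 (kface i)) (O k r))%:~R * (inc (O k.+1 (kface j)) (O k r))%:~R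
      * (wt R X r)^-1)
  else 0.
transitivity (\sum_(r in kfaces X k) F r).
  rewrite [RHS]big_enum_val; apply: eq_bigr => l _; rewrite !mxE /F -/(kface l) /=.
  case: ifP => _; last by rewrite mul0r.
  case: ifP => _; last by rewrite mulr0.
  rewrite -[X in _ = _ * (_ * X^-1)](sqr_sqrtr (ltW (kface_wt_gt0 R l))).
  by rewrite -exprVn; ring.
rewrite -big_mkcondr /= -mulr_sumr; case: ifPn => [_|]; first by rewrite opprK.
rewrite /sim_down negb_or => /andP[nsim nij]; rewrite oppr0.
rewrite big_pred0 ?mulr0 // => r; apply/negP => /and3P[rk ri rj].
by move: nsim; rewrite nij /= => /existsP; apply; exists r; rewrite rk ri rj.
Qed.

Lemma sg_delta k j i : Num.sg (delta R O k j i) =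
  if kface i \subset kface j then (inc (O k.+1 (kface j)) (O k (kface i)))%:~R else 0.
Proof.
rewrite deltaE mxE /=; case: ifP => _; last exact: sgr0.
rewrite !sgrM sgrV !(gtr0_sg (sqrt_kface_wt_gt0 _ _)) !mulr1.
by rewrite /inc; case: ifP => _; rewrite ?rmorphN /= ?sgrN sgr1.
Qed.

Lemma norm_delta k j i : `|delta R O k j i| =
  if kface i \subset kface j then
    Num.sqrt (wt R X (kface j)) / Num.sqrt (wt R X (kface i)) else 0.
Proof.
rewrite deltaE mxE /=; case: ifP => _; last exact: normr0.
rewrite !normrM normfV !(gtr0_norm (sqrt_kface_wt_gt0 _ _)).
have -> : `|(inc (O k.+1 (kface j)) (O k (kface i)))%:~R| = 1 :> R.
  by rewrite /inc; case: ifP => _; rewrite ?rmorphN /= ?normrN normr1.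
by rewrite mul1r.
Qed.

(** Each of the [k.+2] facets contributes the same amount, since its own weight cancels. *)
Lemma delta_row_sum k j :
  \sum_i `|delta R O k j i| * Num.sqrt (wt R X (kface i)) =
  k.+2%:R * Num.sqrt (wt R X (kface j)).
Proof.
pose F (s : {set V}) := if s \subset kface j then Num.sqrt (wt R X (kface j)) else 0.
transitivity (\sum_(s in kfaces X k) F s).
  rewrite [RHS]big_enum_val; apply: eq_bigr => i _; rewrite norm_delta /F -/(kface i).
  by case: ifP => _; rewrite ?mul0r // divfK // gt_eqF ?sqrt_kface_wt_gt0.
rewrite -big_mkcondr /= sumr_const mulr_natl; congr (_ *+ _).
by rewrite -[RHS](card_facets (enum_valP j)); apply: eq_card => s; rewrite [RHS]inE.
Qed.

(** A nonzero column belongs to a face with a cofacet, hence to a non-leaf, where [sum_cofacets_wt]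
    applies. *)
Lemma delta_col_sum k i : (exists j, delta R O k j i != 0) ->
  \sum_j `|delta R O k j i| * (k.+2%:R * Num.sqrt (wt R X (kface j))) =
  Num.sqrt (wt R X (kface i)).
Proof.
move=> [j0]; rewrite -normr_eq0 norm_delta; case: ifP => [ij _|]; last by rewrite eqxx.
have nleaf : ~~ leaf X (kface i).
  have /kfacesP[tX ct] := enum_valP j0; have /kfacesP[_ ci] := enum_valP i.
  by apply: (proper_nonleaf tX ij); rewrite ct ci.
pose F (t : {set V}) := if kface i \subset t then
  k.+2%:R / Num.sqrt (wt R X (kface i)) * wt R X t else 0.
transitivity (\sum_(t in kfaces X k.+1) F t).
  rewrite [RHS]big_enum_val; apply: eq_bigr => j _; rewrite norm_delta /F -/(kface j).
  case: ifP => _; rewrite ?mul0r //.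
  by rewrite -[X in _ = _ * X](sqr_sqrtr (ltW (kface_wt_gt0 R j))); ring.
rewrite -big_mkcondr /= -mulr_sumr mulrAC sum_cofacets_wt ?enum_valP //.
rewrite -[X in X / _](sqr_sqrtr (ltW (kface_wt_gt0 R i))) expr2 mulfK //.
by rewrite gt_eqF ?sqrt_kface_wt_gt0.
Qed.

End Delta.

(** * Coherent orientations and the two Laplacians *)

Section Coherence.
Variables (R : realType) (V : finType) (X : scomplex V) (O : orientation X).
Implicit Types (k : nat) (s t : {set V}) (C : {set {set V}}).

Definition flip_orient (f : {set V} -> bool) k s : oface V k := osign (f s) (O k s).

Lemma flip_orientP f k s : s \in kfaces X k -> oriented_over (flip_orient f k s) s.
Proof. by move=> sk; apply: oriented_over_osign; exact: orientP. Qed.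

Lemma orient_flip (O' : orientation X) k :
  exists f : {set V} -> bool, forall s, s \in kfaces X k -> O' k s = osign (f s) (O k s).
Proof.
suff /choice[f fE] : forall s, exists b, s \in kfaces X k -> O' k s = osign b (O k s).
  by exists f.
move=> s; have [sk|] := boolP (s \in kfaces X k); last by exists true.
by have [b bE] := oriented_over_unique (orientP O sk) (orientP O' sk); exists b.
Qed.

Lemma inc_flip k b c t s : t \in kfaces X k.+1 -> s \in kfaces X k -> s \subset t ->
  inc (osign b (O k.+1 t)) (osign c (O k s)) =
  (-1) ^+ (b (+) c) * inc (O k.+1 t) (O k s).
Proof. by move=> tk sk; apply: inc_osign; apply: orientP. Qed.

Definition up_sign k t s : R := (inc (O k.+1 t) (O k s))%:~R.
Definition down_sign k s t : R := up_sign k t s.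

Lemma sign_eq (b c : bool) (x y : int) :
  (x%:~R * (-1) ^+ b = y%:~R * (-1) ^+ c :> R) <-> ((-1) ^+ b * x = (-1) ^+ c * y).
Proof.
rewrite -![_ * (-1) ^+ _]mulrC; split=> [E|/(congr1 (fun z : int => z%:~R : R))].
  by apply: (@intr_inj R); rewrite !rmorphM !rmorph_sign.
by rewrite !rmorphM !rmorph_sign.
Qed.

(** Any orientation differs from [O] by a sign function, which plays the part of the balancing
    function. Reversing the test face [q] changes both incidences alike, so testing against [O]
    suffices. *)
Lemma coherent_up_balanced k C : C \subset kfaces X k ->
  (exists O' : orientation X,
      forall s s', s \in C -> s' \in C ->
      forall t (q : oface V k.+1),
        t \in kfaces X k.+1 -> oriented_over q t ->
        s \subset t -> s' \subset t ->
        inc q (O' k s) = inc q (O' k s')) <->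
  balanced (kfaces X k.+1) (fun t s => s \subset t) (up_sign k) C.
Proof.
move=> /subsetP CD; split=> [[O' coh]|[f fP]].
  have [f fE] := orient_flip O' k; exists f => s s' t sC s'C tk st s't.
  have := coh s s' sC s'C t (osign false (O k.+1 t)) tk (orientP O tk) st s't.
  by rewrite !fE ?CD // !inc_flip ?CD // => /sign_eq.
exists (Orientation (flip_orientP f)) => s s' sC s'C t q tk qt st s't /=.
have [b ->] := oriented_over_unique (orientP O tk) qt.
rewrite /flip_orient !inc_flip ?CD // !signr_addb -!mulrA; congr (_ * _).
by apply/sign_eq; exact: fP.
Qed.

Lemma coherent_down_balanced k C : C \subset kfaces X k.+1 ->
  (exists O' : orientation X,
      forall t t', t \in C -> t' \in C ->
      forall s (o : oface V k),
        s \in kfaces X k -> oriented_over o s ->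
        s \subset t -> s \subset t' ->
        inc (O' k.+1 t) o = inc (O' k.+1 t') o) <->
  balanced (kfaces X k) (fun s t => s \subset t) (down_sign k) C.
Proof.
move=> /subsetP CD; split=> [[O' coh]|[f fP]].
  have [f fE] := orient_flip O' k.+1; exists f => t t' s tC t'C sk st st'.
  have := coh t t' tC t'C s (osign false (O k s)) sk (orientP O sk) st st'.
  by rewrite !fE ?CD // !inc_flip ?CD // !addbF => /sign_eq.
exists (Orientation (flip_orientP f)) => t t' tC t'C s o sk os st st' /=.
have [b ->] := oriented_over_unique (orientP O sk) os.
rewrite /flip_orient !inc_flip ?CD // ![_ (+) b]addbC !signr_addb -!mulrA; congr (_ * _).
by apply/sign_eq; exact: fP.
Qed.

Lemma component_sub (e : rel {set V}) (D C : {set {set V}}) :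
  component e D C -> C \subset D.
Proof. by move=> /maxsetp/and3P[]. Qed.

Lemma component_neq0 (e : rel {set V}) (D C : {set {set V}}) :
  component e D C -> exists x, x \in C.
Proof. by move=> /maxsetp/and3P[/set0Pn]. Qed.

Lemma up_component_leafP k C : quotient_up_component X k C ->
  ~ (exists2 s, leaf X s & C = [set s]) <->
  exists2 s, s \in C & [exists t in kfaces X k.+1, s \subset t].
Proof.
move=> comp; split=> [nleaf|[s sC /existsP[t /andP[tk st]]] [s' ls' CE]]; last first.
  have /kfacesP[tX ct] := tk; have /kfacesP[_ cs] := subsetP (component_sub comp) _ sC.
  have := proper_nonleaf tX st; rewrite ct cs => /(_ (leqnn _)).
  by move: sC; rewrite CE inE => /eqP ->; rewrite ls'.
have [s sC] := component_neq0 comp; exists s => //.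
have /kfacesP[sX cs] := subsetP (component_sub comp) _ sC.
apply: contraT => nt; have {nleaf}nls : ~~ leaf X s.
  (* A path leaving [s] would begin with a common cofacet, so without cofacets the component is [s]
     alone. *)
  apply/negP => ls; apply: nleaf; exists s => //.
  have adj_sym : symmetric (up_adj X k).
    by move=> x y; rewrite /up_adj andbCA eq_sym setUC.
  have adj_dom x y : up_adj X k x y -> y \in kfaces X k by case/and4P.
  have [x xD CE] := componentP adj_sym adj_dom C comp.
  apply/setP => y; rewrite inE; apply/idP/eqP => [yC|->//].
  move: sC yC; rewrite CE !inE => xs; rewrite (same_connect (sym_connect_sym adj_sym) xs).
  move=> /connectP[[|z r] /= +  -> //] => /andP[]; rewrite up_adjE.
  move=> /and4P[_ _ _ /existsP[t /and3P[tk st _]]] _; case/negP: nt.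
  by apply/existsP; exists t; rewrite tk st.
have [t tX /andP[st /eqP ct]] := nonleaf_cofacet sX nls.
by case/negP: nt; apply/existsP; exists t; rewrite st inE tX ct cs eqxx.
Qed.

Lemma down_component_facet k C : quotient_down_component X k.+1 C ->
  exists2 t, t \in C & [exists s in kfaces X k, s \subset t].
Proof.
move=> comp; have [t tC] := component_neq0 comp; exists t => //.
have tk := subsetP (component_sub comp) _ tC.
have /card_gt0P[s] : (0 < #|[set s in kfaces X k | s \subset t]|)%N.
  by rewrite card_facets.
by rewrite inE => st; apply/existsP; exists s.
Qed.

Lemma down_component_not_vertex k C : quotient_down_component X k.+1 C ->
  ~ (exists x : V, C = [set [set x]]).
Proof.
move=> comp [x CE].
have /kfacesP[_] : [set x] \in kfaces X k.+1.
  by apply: (subsetP (component_sub comp)); rewrite CE set11.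
by rewrite cards1.
Qed.

Lemma Lap_up_eigenvalue_le1 k a : eigenvalue (Lap_up R O k) a -> a <= 1.
Proof.
apply: (schur_eigenvalue_le1 (@sqrt_kface_wt_gt0 R V X k)) => [j _|i].
  exact: delta_row_sum.
exact: delta_col_sum.
Qed.

Let q_gt0 k (j : 'I_#|kfaces X k.+1|) : 0 < k.+2%:R * Num.sqrt (wt R X (kface j)).
Proof. by rewrite mulr_gt0 ?ltr0n ?sqrt_kface_wt_gt0. Qed.

(** For the transpose the two weights exchange their roles, and so do the row and column
    conditions. *)
Let tr_row_sum k i : (exists j, (delta R O k)^T i j != 0) ->
  \sum_j `|(delta R O k)^T i j| * (k.+2%:R * Num.sqrt (wt R X (kface j))) =
  Num.sqrt (wt R X (kface i)).
Proof.
move=> [j]; rewrite mxE => ji; rewrite -(@delta_col_sum R V X O); last by exists j.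
by apply: eq_bigr => l _; rewrite mxE.
Qed.

Let tr_col_sum k j : (exists i, (delta R O k)^T i j != 0) ->
  \sum_i `|(delta R O k)^T i j| * Num.sqrt (wt R X (kface i)) =
  k.+2%:R * Num.sqrt (wt R X (kface j)).
Proof.
by move=> _; rewrite -(@delta_row_sum R V X O); apply: eq_bigr => l _; rewrite mxE.
Qed.

Lemma Lap_down_eigenvalue_le1 k a : eigenvalue (Lap_down R O k) a -> a <= 1.
Proof.
case: k => [|k].
  (* In dimension 0 the matrix is zero, so its eigenvalues can only be 0. *)
  move=> /eigenvalueP[v]; rewrite mulmx0 => /esym/eqP; rewrite scaler_eq0.
  by case/orP => [/eqP ->|/eqP ->]; rewrite ?ler01 // eqxx.
rewrite /Lap_down -{1}[delta R O k]trmxK.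
exact: (schur_eigenvalue_le1 (@q_gt0 k) (@tr_row_sum k) (@tr_col_sum k)).
Qed.

Lemma rank_eigen1_up k :
  \rank (eigenspace (Lap_up R O k) 1) = num_coherent_up X k.
Proof.
have sqr1 t s : up_sign k t s ^+ 2 = 1 by rewrite -rmorphXn /= inc_sqr.
apply: (rank_eigenspace_balanced (@sqrt_kface_wt_gt0 R V X k)
  (fun j _ => delta_row_sum R O j) (@delta_col_sum R V X O k)
  (I := fun t s => s \subset t) sqr1 (@sg_delta R V X O k) (@up_adjE V X k)).
move=> C; rewrite inE; split=> [/asboolP[comp nleaf coh]|[comp ex bal]].
  split=> //; first exact/(up_component_leafP comp).
  exact/(coherent_up_balanced (component_sub comp)).
apply/asboolP; split=> //; first exact/(up_component_leafP comp).
exact/(coherent_up_balanced (component_sub comp)).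
Qed.

Lemma rank_eigen1_down k :
  \rank (eigenspace (Lap_down R O k.+1) 1) = num_coherent_down X k.+1.
Proof.
rewrite /Lap_down -{1}[delta R O k]trmxK.
have sqr1 s t : down_sign k s t ^+ 2 = 1 by rewrite -rmorphXn /= inc_sqr.
have sg i j : Num.sg ((delta R O k)^T i j) =
    if kface i \subset kface j then down_sign k (kface i) (kface j) else 0.
  by rewrite mxE sg_delta.
apply: (rank_eigenspace_balanced (@q_gt0 k) (@tr_row_sum k) (@tr_col_sum k)
  (I := fun s t => s \subset t) sqr1 sg (@down_adjE V X k)).
move=> C; rewrite inE; split=> [/asboolP[comp _ coh]|[comp ex bal]].
  split=> //; first exact: down_component_facet.
  exact/(coherent_down_balanced (component_sub comp)).
apply/asboolP; split=> //; first exact: down_component_not_vertex comp.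
exact/(coherent_down_balanced (component_sub comp)).
Qed.

Lemma Lap_up_sym k : (Lap_up R O k)^T = Lap_up R O k.
Proof. exact: gram_sym. Qed.

Lemma Lap_down_sym k : (Lap_down R O k.+1)^T = Lap_down R O k.+1.
Proof. by rewrite /Lap_down trmx_mul trmxK. Qed.

Lemma rank_eigen1_up_down k :
  \rank (eigenspace (Lap_up R O k) 1) = \rank (eigenspace (Lap_down R O k.+1) 1).
Proof.
apply/eqP; rewrite eqn_leq gram_rank_eigenspace_le ?oner_eq0 //=.
by have := @gram_rank_eigenspace_le _ _ _ (delta R O k)^T 1 (oner_neq0 _); rewrite trmxK.
Qed.

(** Nonzero eigenvalues pass between [M^T *m M] and [M *m M^T]. If one maximum is 0, nonnegativity
    of the other gives the required inequality. *)
Lemma lambda_max_up_down k lu ld :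
  is_lambda_max (Lap_up R O k) lu -> is_lambda_max (Lap_down R O k.+1) ld -> lu = ld.
Proof.
move=> [eu maxu] [ed maxd].
have lu0 : 0 <= lu by exact: gram_eigenvalue_ge0 eu.
have ld0 : 0 <= ld.
  by apply: (@gram_eigenvalue_ge0 _ _ _ (delta R O k)^T); rewrite trmxK.
apply/eqP; rewrite eq_le; apply/andP; split.
  have [->//|n0] := eqVneq lu 0; apply: maxd; exact: gram_eigenvalue_tr.
have [->//|n0] := eqVneq ld 0; apply: maxu.
by have := @gram_eigenvalue_tr _ _ _ (delta R O k)^T ld n0; rewrite trmxK; apply.
Qed.

Lemma eigenvalue_rank n (A : 'M[R]_n) a :
  eigenvalue A a = (0 < \rank (eigenspace A a))%N.
Proof. by rewrite lt0n mxrank_eq0. Qed.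

Lemma lambda_max_eq1 n (A : 'M[R]_n) l :
  (forall a, eigenvalue A a -> a <= 1) -> is_lambda_max A l ->
  1 - l = 0 <-> eigenvalue A 1.
Proof.
move=> A1 [el maxl]; split=> [/eqP|e1].
  by rewrite subr_eq0 => /eqP ->.
by apply/eqP; rewrite subr_eq0 eq_le maxl // A1.
Qed.

End Coherence.

Theorem theorem2p5 (R : realType) (V : finType) (X : scomplex V)
    (O : orientation X) :
  [/\ forall k : nat, k%:Z <= sdim X -> delta R O k = deltaO R O k,
      forall k : nat, k%:Z <= sdim X ->
        Lap_up R O k = - A_up R O k /\ Lap_down R O k = - A_down R O k,
      forall k : nat, k%:Z <= sdim X ->
        (forall a : R, eigenvalue (Lap_up R O k) a -> a <= 1) /\
        (forall a : R, eigenvalue (Lap_down R O k) a -> a <= 1)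
    & forall k : nat, (1 <= k)%N -> k%:Z <= sdim X ->
      (exists lup ldown : R,
        [/\ is_lambda_max (Lap_up R O k.-1) lup,
            is_lambda_max (Lap_down R O k) ldown,
            1 - lup = 1 - ldown,
            1 - lup = 0 <-> (exists C, coherent_up_component X k.-1 C)
          & 1 - ldown = 0 <-> (exists C, coherent_down_component X k C)]) /\
      [/\ (exists C, coherent_up_component X k.-1 C) <->
          (exists C, coherent_down_component X k C),
          eig_mult (Lap_up R O k.-1) 1 = eig_mult (Lap_down R O k) 1,
          eig_mult (Lap_up R O k.-1) 1 = num_coherent_up X k.-1
        & eig_mult (Lap_down R O k) 1 = num_coherent_down X k]].
Proof.
split=> [k _|k _|k _|[//|k] _ kdim].
- exact: deltaE.
- by split; [exact: Lap_upE|exact: Lap_downE].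
- by split=> a; [exact: Lap_up_eigenvalue_le1|exact: Lap_down_eigenvalue_le1].
(* Both matrices must have positive size for a largest eigenvalue to exist. *)
have kgt0 := kfaces_card_gt0 kdim.
have upE : (exists C, coherent_up_component X k C) <-> eigenvalue (Lap_up R O k) 1.
  rewrite eigenvalue_rank rank_eigen1_up; split=> [[C CP]|/card_gt0P[C]].
    by apply/card_gt0P; exists C; rewrite inE; apply/asboolP.
  by rewrite inE => /asboolP; exists C.
have downE : (exists C, coherent_down_component X k.+1 C) <->
    eigenvalue (Lap_down R O k.+1) 1.
  rewrite eigenvalue_rank rank_eigen1_down; split=> [[C CP]|/card_gt0P[C]].
    by apply/card_gt0P; exists C; rewrite inE; apply/asboolP.
  by rewrite inE => /asboolP; exists C.
have [lu luP] := sym_lambda_max (Lap_up_sym R O k) (kfaces_pred_card_gt0 kgt0).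
have [ld ldP] := sym_lambda_max (Lap_down_sym R O k) kgt0.
split.
  exists lu, ld; split=> //=; first by rewrite (lambda_max_up_down luP ldP).
    by rewrite upE; exact: lambda_max_eq1 (@Lap_up_eigenvalue_le1 R V X O k) luP.
  by rewrite downE; exact: lambda_max_eq1 (@Lap_down_eigenvalue_le1 R V X O k.+1) ldP.
(* Symmetry replaces the algebraic multiplicities by dimensions of eigenspaces, which count coherent
   components. *)
rewrite /eig_mult /= !mup_char_poly_sym ?Lap_up_sym ?Lap_down_sym //.
split.
- by rewrite upE downE !eigenvalue_rank rank_eigen1_up_down.
- exact: rank_eigen1_up_down.
- exact: rank_eigen1_up.
- exact: rank_eigen1_down.
Qed.
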